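(* Let $\mathbb K$ be an algebraically closed field of characteristic $3$. (a1) For $\mathfrak g=\mathfrak{gl}(3)$, for a basis of $H^1(\mathfrak g;\mathfrak g)$ one can take the class of the derivation $$c_0=2h_1\otimes\widehat D_3+h_2\otimes\widehat D_3 .$$ (a2) $H^2(\mathfrak{gl}(3))=0$. (b1) For $\mathfrak g=\mathfrak{psl}(3)$, for a basis of $H^1(\mathfrak g;\mathfrak g)$ one can take the classes of the following $7$ derivations: - of degree $-3$: $\ y_1\otimes\widehat x_3+y_3\otimes\widehat x_1,\quad y_2\otimes\widehat x_3+y_3\otimes\widehat x_2$; - of degree $0$: $\ 2x_2\otimes\widehat x_1+y_1\otimes\widehat y_2,\quad 2x_1\otimes\widehat x_2+y_2\otimes\widehat y_1,\quad x_1\otimes\widehat x_1+2x_2\otimes\widehat x_2+2y_1\otimes\widehat y_1+y_2\otimes\widehat y_2$; - of degree $3$: $\ x_1\otimes\widehat y_3+x_3\otimes\widehat y_1,\quad x_2\otimes\widehat y_3+x_3\otimes\widehat y_2$. (b2) $\dim H^2(\mathfrak{psl}(3))=7$, and for a basis one can take the classes of the following cocycles: - of degree $-3$: $\ \widehat x_2\wedge\widehat x_3,\quad \widehat x_1\wedge\widehat x_3$; - of degree $0$: $\ \widehat x_1\wedge\widehat y_2,\quad \widehat x_2\wedge\widehat y_2-\widehat x_1\wedge\widehat y_1,\quad \widehat x_2\wedge\widehat y_1$; - of degree $3$: $\ \widehat y_2\wedge\widehat y_3,\quad \widehat y_1\wedge\widehat y_3$.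
   Context: Here $x_1=E_{1,2}$, $x_2=E_{2,3}$, $x_3=[x_1,x_2]$, $y_1=E_{2,1}$, $y_2=E_{3,2}$, $y_3=[y_1,y_2]$, $h_i=[x_i,y_i]$ for $i=1,2$, so $h_1=E_{1,1}-E_{2,2}$ and $h_2=E_{2,2}-E_{3,3}$. The grading is $\deg x_1=\deg x_2=1$, $\deg y_1=\deg y_2=-1$. For $\mathfrak{gl}(3)$: $D_3=E_{1,1}$ is the grading operator, complementing $\mathfrak{sl}(3)$ to $\mathfrak{gl}(3)$; $\widehat D_3$ is the linear functional on $\mathfrak{gl}(3)$ that vanishes on $\mathfrak{sl}(3)$ and equals $1$ on $D_3$. $\mathfrak{psl}(3)=\mathfrak{sl}(3)/\mathbb K 1_3$ (in characteristic $3$ the identity matrix is traceless); it has the basis consisting of the images of $x_1,x_2,x_3,y_1,y_2,y_3$ and $h_1$ (the images of $h_1$ and $h_2$ coincide), and $\widehat x_i,\widehat y_i$ are elements of the dual basis. $u\otimes\widehat w$ is the linear map $X\mapsto\widehat w(X)u$. $H^1(\mathfrak g;\mathfrak g)$ is the space of derivations modulo inner ones; $H^2(\mathfrak g)$ is Chevalley--Eilenberg cohomology with trivial coefficients. *)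

(* Defs.v *)
From HB Require Import structures.
From mathcomp Require Import all_boot all_order all_algebra.
From mathcomp Require Import ring_quotient boolp ring.

Set Implicit Arguments.
Unset Strict Implicit.
Unset Printing Implicit Defensive.

Import GRing.Theory.
Local Open Scope ring_scope.
Local Open Scope quotient_scope.

Section VspaceOf.
Variables (K : fieldType) (V : vectType K).

Definition subspace_pred (P : V -> Prop) : Prop :=
  P 0 /\ forall a u v, P u -> P v -> P (a *: u + v).

Lemma vspace_of_exists (P : V -> Prop) :
  subspace_pred P -> exists U : {vspace V}, forall v, v \in U <-> P v.
Proof.
move=> [P0 Plin].
have aux n : forall U : {vspace V}, (\dim {: V} - \dim U <= n)%N ->
    (forall v, v \in U -> P v) ->
    exists U' : {vspace V}, forall v, v \in U' <-> P v.
  elim: n => [|n IHn] U leUn UP.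
    have eqU : U = fullv.
      by apply/eqP; rewrite eqEdim subvf /= -subn_eq0 -leqn0.
    by exists U => v; split=> [/UP//|_]; rewrite eqU memvf.
  have [[w Pw wU]|noW] := pselect (exists2 w, P w & w \notin U); last first.
    exists U => v; split; first exact: UP.
    by move=> Pv; apply: contra_notT noW => vU; exists v.
  apply: (IHn (U + <[w]>)%VS).
    have ltU : (\dim U < \dim (U + <[w]>))%N.
      rewrite ltnNge; apply: contra wU => leU.
      have /eqP -> : U == (U + <[w]>)%VS by rewrite eqEdim addvSl.
      by apply: (subvP (addvSr _ _)); apply: memv_line.
    rewrite leq_subLR in leUn; rewrite leq_subLR (leq_trans leUn) //.
    by rewrite -addSnnS leq_add2r.
  move=> _ /memv_addP[u uU [_ /vlineP[a ->] ->]].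
  by rewrite addrC; apply: Plin => //; apply: UP.
apply: (aux (\dim {: V}) 0%VS); first exact: leq_subr.
by move=> v; rewrite memv0 => /eqP->.
Qed.

Definition vspace_of (P : V -> Prop) (hP : subspace_pred P) : {vspace V} :=
  projT1 (cid (vspace_of_exists hP)).

Lemma mem_vspace_of (P : V -> Prop) (hP : subspace_pred P) v :
  v \in vspace_of hP <-> P v.
Proof. by rewrite /vspace_of; case: cid => U /= ->. Qed.

End VspaceOf.

Section VQuot.
Variables (K : fieldType) (V : vectType K) (U : {vspace V}).

Definition vquot : Type := Quotient.quot (pred_of_vspace U).

HB.instance Definition _ := GRing.Zmodule.on vquot.

Definition vpi (v : V) : vquot := \pi_(Quotient.quot (pred_of_vspace U)) v.
Definition vrepr (q : vquot) : V := repr q.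

Lemma vreprK : cancel vrepr vpi.
Proof. exact: reprK. Qed.

Lemma vpi_eq u v : (vpi u == vpi v) = (u - v \in U).
Proof. by rewrite (Quotient.idealrBE (pred_of_vspace U)). Qed.

Lemma vpi_is_zmod_morphism : zmod_morphism vpi.
Proof. exact: pi_is_zmod_morphism. Qed.

HB.instance Definition _ :=
  GRing.isZmodMorphism.Build V vquot vpi vpi_is_zmod_morphism.

Definition vquot_scale (a : K) (q : vquot) : vquot := vpi (a *: vrepr q).

Lemma vpi_scale a v : vpi (a *: v) = vquot_scale a (vpi v).
Proof.
by apply/eqP; rewrite vpi_eq -scalerBr memvZ // -vpi_eq vreprK.
Qed.

Fact vquot_scaleA a b q :
  vquot_scale a (vquot_scale b q) = vquot_scale (a * b) q.
Proof. by rewrite -[q]vreprK -!vpi_scale scalerA. Qed.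

Fact vquot_scale1 : left_id 1 vquot_scale.
Proof. by move=> q; rewrite -[q]vreprK -vpi_scale scale1r. Qed.

Fact vquot_scaleDr : right_distributive vquot_scale +%R.
Proof.
move=> a q r; rewrite -[q]vreprK -[r]vreprK -raddfD -!vpi_scale.
by rewrite scalerDr raddfD.
Qed.

Fact vquot_scaleDl q : {morph vquot_scale^~ q : a b / a + b}.
Proof. by move=> a b; rewrite -[q]vreprK -!vpi_scale scalerDl raddfD. Qed.

HB.instance Definition _ := GRing.Zmodule_isLmodule.Build K vquot
  vquot_scaleA vquot_scale1 vquot_scaleDr vquot_scaleDl.

Fact vpi_is_scalable : scalable vpi.
Proof. exact: vpi_scale. Qed.

HB.instance Definition _ :=
  GRing.isScalable.Build K V vquot _ vpi vpi_is_scalable.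

(* Coordinates on V / U: those of the component along the complement U^C.     *)
Let f (v : V) : 'rV[K]_(\dim (U^C)) :=
  \row_i coord (vbasis (U^C)) i (v - projv U v).

Let f_linear : linear f.
Proof.
move=> a u v; apply/rowP=> i; rewrite !mxE -linearP; congr (coord _ _ _).
by rewrite linearP scalerBr opprD addrACA.
Qed.

Let fpi v : f (vrepr (vpi v)) = f v.
Proof.
have : vrepr (vpi v) - v \in U by rewrite -vpi_eq vreprK.
set w := vrepr _ => wU; have -> : w = 1 *: (w - v) + v by rewrite scale1r subrK.
rewrite f_linear scale1r -[RHS]add0r; congr (_ + _).
by apply/rowP=> i; rewrite !mxE projv_id // subrr linear0.
Qed.

Lemma vquot_vect_iso : Vector.axiom (\dim (U^C)) vquot.
Proof.
exists (f \o vrepr).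
  move=> a q r /=; rewrite -{1}[q]vreprK -{1}[r]vreprK -linearP.
  by rewrite fpi f_linear.
exists (fun rw : 'rV_(\dim (U^C)) => vpi (\sum_i rw 0 i *: (vbasis (U^C))`_i)).
  move=> q; rewrite -[RHS]vreprK; apply/eqP; rewrite vpi_eq /=.
  under eq_bigr do rewrite mxE.
  rewrite -coord_vbasis ?memv_projC //.
  by rewrite addrAC subrr sub0r rpredN memv_proj.
move=> rw /=; rewrite fpi; apply/rowP=> i; rewrite mxE.
set w := \sum_i _.
have wUC : w \in (U^C)%VS.
  by apply: rpred_sum => j _; rewrite rpredZ ?vbasis_mem ?memt_nth.
have -> : projv U w = 0.
  have pwUC : projv U w \in (U^C)%VS.
    by rewrite -[projv U w](subKr w) rpredB ?memv_projC.
  apply/eqP; rewrite -memv0 -(capv_compl U) memv_cap memv_proj.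
  exact: pwUC.
by rewrite subr0 coord_sum_free ?(basis_free (vbasisP _)).
Qed.

HB.instance Definition _ := Lmodule_hasFinDim.Build K vquot vquot_vect_iso.

End VQuot.

Arguments vpi {K V} U v.

HB.mixin Record Vector_isLie (K : fieldType) L of Vector K L := {
  lie : L -> L -> L;
  lie_is_linear_l : forall y, linear (lie^~ y);
  lie_is_linear_r : forall x, linear (lie x);
  liexx : forall x, lie x x = 0;
  lie_jacobi : forall x y z,
    lie x (lie y z) + lie y (lie z x) + lie z (lie x y) = 0
}.

#[short(type="lieAlgType")]
HB.structure Definition LieAlgebra (K : fieldType) :=
  {L of Vector_isLie K L & Vector K L}.

Notation "[ 'lie' x , y ]" := (lie x y)
  (at level 0, x at level 99, y at level 99, format "[ 'lie'  x ,  y ]") : ring_scope.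

Section LieTheory.
Variables (K : fieldType) (L : lieAlgType K).
Implicit Types x y z : L.

Lemma lie_linearl y a u v : [lie a *: u + v, y] = a *: [lie u, y] + [lie v, y].
Proof. exact: lie_is_linear_l. Qed.

Lemma lie_linearr x a u v : [lie x, a *: u + v] = a *: [lie x, u] + [lie x, v].
Proof. exact: lie_is_linear_r. Qed.

HB.instance Definition _ x :=
  GRing.isLinear.Build K L L _ (lie x) (lie_is_linear_r x).

Lemma lieDl u v y : [lie u + v, y] = [lie u, y] + [lie v, y].
Proof. by rewrite -[u]scale1r lie_linearl !scale1r. Qed.

Lemma lie0l y : [lie 0, y] = 0.
Proof. by apply: (addrI [lie 0, y]); rewrite -lieDl !addr0. Qed.

Lemma lieZl a u y : [lie a *: u, y] = a *: [lie u, y].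
Proof. by rewrite -[a *: u]addr0 lie_linearl lie0l addr0. Qed.

Lemma lieDr x u v : [lie x, u + v] = [lie x, u] + [lie x, v].
Proof. exact: linearD. Qed.

Lemma lieZr x a u : [lie x, a *: u] = a *: [lie x, u].
Proof. exact: linearZ. Qed.

Lemma lie0r x : [lie x, 0] = 0.
Proof. exact: linear0. Qed.

Lemma lieNr x u : [lie x, - u] = - [lie x, u].
Proof. exact: raddfN. Qed.

Lemma lieC x y : [lie x, y] = - [lie y, x].
Proof.
apply/eqP; rewrite -addr_eq0; have := liexx (x + y).
by rewrite lieDl !lieDr !liexx add0r addr0 => ->.
Qed.

End LieTheory.

(* H^1(L; L) is the image of Der L in End(L) / Inn L: since Inn L <= Der L,   *)
(* it is Der L / Inn L, and (mem_class1) class1 D lies in it iff D is a       *)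
(* derivation.                                                                *)

Section AdjointH1.
Variables (K : fieldType) (L : lieAlgType K).
Implicit Types D : 'End(L).

Definition is_derivation D : Prop :=
  forall x y, D [lie x, y] = [lie D x, y] + [lie x, D y].

Definition is_inner D : Prop := exists a : L, forall x, D x = [lie a, x].

Fact is_derivation_subspace : subspace_pred is_derivation.
Proof.
split=> [x y|a D1 D2 h1 h2 x y]; first by rewrite !lfunE /= lie0l lie0r addr0.
rewrite !(add_lfunE, scale_lfunE) h1 h2 lie_linearl lie_linearr scalerDr.
by rewrite addrACA.
Qed.

Fact is_inner_subspace : subspace_pred is_inner.
Proof.
split=> [|a D1 D2 [u1 h1] [u2 h2]].
  by exists 0 => x; rewrite lfunE /= lie0l.
exists (a *: u1 + u2) => x.
by rewrite !(add_lfunE, scale_lfunE) h1 h2 lie_linearl.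
Qed.

Definition Der : {vspace 'End(L)} := vspace_of is_derivation_subspace.
Definition Inn : {vspace 'End(L)} := vspace_of is_inner_subspace.

Lemma memDer D : D \in Der <-> is_derivation D.
Proof. exact: mem_vspace_of. Qed.

Lemma memInn D : D \in Inn <-> is_inner D.
Proof. exact: mem_vspace_of. Qed.

Lemma Inn_sub_Der : (Inn <= Der)%VS.
Proof.
apply/subvP => D /memInn[a aD]; apply/memDer => x y; rewrite !aD.
have := lie_jacobi a x y.
rewrite [[lie y, a]]lieC linearN /= [[lie y, [lie a, x]]]lieC => /eqP.
by rewrite addrAC subr_eq0 => /eqP e; rewrite -[LHS](addrK (- [lie [lie a, x], y])) e opprK addrC.
Qed.

Definition H1 : {vspace vquot Inn} := (linfun (vpi Inn) @: Der)%VS.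
Definition class1 D : vquot Inn := vpi Inn D.

Lemma mem_class1 D : (class1 D \in H1) = (D \in Der).
Proof.
apply/idP/idP => [/memv_imgP[E ED /eqP]|DD]; last first.
  by apply/memv_imgP; exists D; rewrite ?lfunE.
rewrite lfunE vpi_eq => /(subvP Inn_sub_Der) DE.
by rewrite -(subrK E D) rpredD.
Qed.

End AdjointH1.

(* Chevalley--Eilenberg cohomology with trivial coefficients, in degree 2.    *)
(* A 2-cochain is an alternating bilinear form; bilinear forms are elements   *)
(* of 'Hom(L, 'Hom(L, K^o)). As above, H2 is the image of Z2 in the quotient  *)
(* of the space of all bilinear forms by B2, i.e., Z2 / B2.                   *)

Section TrivialH2.
Variables (K : fieldType) (L : lieAlgType K).

Definition bilform := 'Hom(L, 'Hom(L, K^o)).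
HB.instance Definition _ := Vector.on bilform.
Implicit Types (w : bilform) (f : 'Hom(L, K^o)).

Definition ce_d1 f (x y : L) : K := - f [lie x, y].

Definition ce_d2 w (x y z : L) : K :=
  - w [lie x, y] z + w [lie x, z] y - w [lie y, z] x.

Definition is_cocycle2 w : Prop :=
  (forall x, w x x = 0) /\ forall x y z, ce_d2 w x y z = 0.

Definition is_coboundary2 w : Prop :=
  exists f, forall x y, w x y = ce_d1 f x y.

Fact is_cocycle2_subspace : subspace_pred is_cocycle2.
Proof.
split=> [|a w1 w2 [alt1 h1] [alt2 h2]].
  by split=> [x|x y z]; rewrite /ce_d2 !zero_lfunE //= ?oppr0 ?addr0.
split=> [x|x y z]; first by rewrite !(add_lfunE, scale_lfunE) alt1 alt2 scaler0 addr0.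
have aux (p q r p' q' r' : K) : - p + q - r = 0 -> - p' + q' - r' = 0 ->
    - (a * p + p') + (a * q + q') - (a * r + r') = 0.
  move=> e e'; transitivity (a * (- p + q - r) + (- p' + q' - r')); first by ring.
  by rewrite e e' mulr0 addr0.
have := aux _ _ _ _ _ _ (h1 x y z) (h2 x y z).
by rewrite /ce_d2 !(add_lfunE, scale_lfunE).
Qed.

Fact is_coboundary2_subspace : subspace_pred is_coboundary2.
Proof.
split=> [|a w1 w2 [f1 h1] [f2 h2]].
  by exists 0 => x y; rewrite /ce_d1 !zero_lfunE oppr0.
exists (a *: f1 + f2) => x y.
by rewrite /ce_d1 !(add_lfunE, scale_lfunE) h1 h2 /ce_d1 opprD scalerN.
Qed.

Definition Z2 : {vspace bilform} := vspace_of is_cocycle2_subspace.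
Definition B2 : {vspace bilform} := vspace_of is_coboundary2_subspace.

Lemma memZ2 w : w \in Z2 <-> is_cocycle2 w.
Proof. exact: mem_vspace_of. Qed.

Lemma memB2 w : w \in B2 <-> is_coboundary2 w.
Proof. exact: mem_vspace_of. Qed.

Lemma B2_sub_Z2 : (B2 <= Z2)%VS.
Proof.
apply/subvP => w /memB2[f fw]; apply/memZ2; split=> [x|x y z].
  by rewrite fw /ce_d1 liexx linear0 oppr0.
rewrite /ce_d2 !fw /ce_d1 !opprK.
have -> : [lie [lie y, z], x] = - [lie [lie x, y], z] + [lie [lie x, z], y].
  rewrite (lieC [lie y, z] x) (lieC [lie x, y] z) (lieC [lie x, z] y).
  rewrite (lieC x z) lieNr !opprK -[RHS]opprK; congr (- _).
  by apply/eqP; rewrite -addr_eq0 addrCA addrC lie_jacobi.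
by rewrite linearD linearN /=; ring.
Qed.

Definition H2 : {vspace vquot B2} := (linfun (vpi B2) @: Z2)%VS.
Definition class2 w : vquot B2 := vpi B2 w.

Lemma mem_class2 w : (class2 w \in H2) = (w \in Z2).
Proof.
apply/idP/idP => [/memv_imgP[v vZ /eqP]|wZ]; last first.
  by apply/memv_imgP; exists w; rewrite ?lfunE.
rewrite lfunE vpi_eq => /(subvP B2_sub_Z2) wv.
by rewrite -(subrK v w) rpredD.
Qed.

End TrivialH2.

(* u \ox f is the rank one map X |-> f X *: u; f \wedge g is                  *)
(* (X, Y) |-> f X * g Y - f Y * g X.                                          *)

Section TensorWedge.
Variables (K : fieldType) (L : lieAlgType K).
Implicit Types (u : L) (f g : 'Hom(L, K^o)).

Definition tens u f : 'End(L) := linfun (fun x => (f x : K) *: u).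

Definition wedge f g : bilform L :=
  linfun (fun x => (f x : K) *: g - (g x : K) *: f).

Lemma tensE u f x : tens u f x = (f x : K) *: u.
Proof.
pose h y := (f y : K) *: u.
have hl : linear h by move=> a y z; rewrite /h linearP scalerDl -scalerA.
exact: (lfunE (HB.pack h (GRing.isLinear.Build K L L _ h hl) : {linear L -> L})).
Qed.

Lemma wedgeE f g x y : wedge f g x y = (f x : K) * g y - (f y : K) * g x.
Proof.
pose h z := (f z : K) *: g - (g z : K) *: f.
have hl : linear h.
  move=> a z t; rewrite /h (linearP f) (linearP g) !scalerDl -!scalerA scalerBr opprD.
  by rewrite addrACA.
rewrite (lfunE (HB.pack h (GRing.isLinear.Build K L _ _ h hl)
  : {linear L -> 'Hom(L, K^o)})) /= /h add_lfunE.
by rewrite opp_lfunE !scale_lfunE [X in _ - X]mulrC.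
Qed.

End TensorWedge.

Notation "u \ox f" := (tens u f) (at level 40, no associativity) : ring_scope.
Notation "f \wedge g" := (wedge f g) (at level 40, no associativity) : ring_scope.

(* psl(n) = sl(n) / (sl(n) :&: K 1_n); the identity matrix is traceless, so   *)
(* that this is sl(n) / K 1_n, when the characteristic of K divides n.        *)

Definition gl (K : fieldType) (n : nat) : Type := 'M[K]_n.

Section Gl.
Variables (K : fieldType) (n : nat).

HB.instance Definition _ := Vector.on (gl K n).

Definition gl_lie (A B : gl K n) : gl K n := A *m B - B *m A.

Fact gl_lie_linear_l B : linear (gl_lie^~ B).
Proof.
move=> a A A'; rewrite /gl_lie mulmxDl mulmxDr -scalemxAl -scalemxAr scalerBr.
by rewrite opprD addrACA.
Qed.

Fact gl_lie_linear_r A : linear (gl_lie A).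
Proof.
move=> a B B'; rewrite /gl_lie mulmxDl mulmxDr -scalemxAl -scalemxAr scalerBr.
by rewrite opprD addrACA.
Qed.

Fact gl_liexx A : gl_lie A A = 0.
Proof. exact: subrr. Qed.

Fact gl_jacobi A B C :
  gl_lie A (gl_lie B C) + gl_lie B (gl_lie C A) + gl_lie C (gl_lie A B) = 0.
Proof.
rewrite /gl_lie !(mulmxBl, mulmxBr) !mulmxA.
move: (A *m B *m C) (A *m C *m B) (B *m A *m C) (B *m C *m A) (C *m A *m B).
by move: (C *m B *m A) => *; apply/matrixP=> i j; rewrite !mxE; ring.
Qed.

HB.instance Definition _ := Vector_isLie.Build K (gl K n)
  gl_lie_linear_l gl_lie_linear_r gl_liexx gl_jacobi.

Lemma gl_lieE (A B : gl K n) : [lie A, B] = A *m B - B *m A.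
Proof. by []. Qed.

Definition sl_vs : {vspace gl K n} :=
  lker (linfun (mxtrace : gl K n -> K^o)).

Lemma mem_sl_vs (A : gl K n) : (A \in sl_vs) = (\tr A == 0).
Proof. by rewrite memv_ker (lfunE (mxtrace : {linear 'M[K]_n -> K^o})). Qed.

Definition sl : Type := subvs_of sl_vs.
HB.instance Definition _ := Vector.on sl.

Lemma sl_lie_subproof (A B : gl K n) : [lie A, B] \in sl_vs.
Proof. by rewrite mem_sl_vs gl_lieE linearB /= mxtrace_mulC subrr. Qed.

Definition sl_lie (A B : sl) : sl := Subvs (sl_lie_subproof (vsval A) (vsval B)).

Fact sl_lie_linear_l B : linear (sl_lie^~ B).
Proof. by move=> a A A'; apply: val_inj; apply: lie_linearl. Qed.

Fact sl_lie_linear_r A : linear (sl_lie A).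
Proof. by move=> a B B'; apply: val_inj; apply: lie_linearr. Qed.

Fact sl_liexx A : sl_lie A A = 0.
Proof. by apply: val_inj; apply: liexx. Qed.

Fact sl_jacobi A B C :
  sl_lie A (sl_lie B C) + sl_lie B (sl_lie C A) + sl_lie C (sl_lie A B) = 0.
Proof. by apply: val_inj; apply: lie_jacobi. Qed.

HB.instance Definition _ := Vector_isLie.Build K sl
  sl_lie_linear_l sl_lie_linear_r sl_liexx sl_jacobi.

Lemma val_sl_lie (A B : sl) : vsval [lie A, B] = [lie (vsval A : gl K n), vsval B].
Proof. by []. Qed.

Definition sl_scalars : {vspace sl} :=
  (linfun (@vsval K (gl K n) sl_vs : sl -> gl K n) @^-1: <[(1%:M : gl K n)]>)%VS.

Lemma mem_sl_scalars (A : sl) :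
  reflect (exists a, vsval A = a%:M) (A \in sl_scalars).
Proof.
rewrite -memv_preim (lfunE (@vsval K (gl K n) sl_vs : {linear _ -> _})).
apply: (iffP (vlineP _ _)) => -[a e]; exists a; move: e; rewrite /= scalemx1 //.
Qed.

Definition psl : Type := vquot sl_scalars.
HB.instance Definition _ := Vector.on psl.

Definition psl_pi (A : sl) : psl := vpi sl_scalars A.
HB.instance Definition _ := GRing.Linear.copy psl_pi (vpi sl_scalars).

Definition psl_lie (q r : psl) : psl := psl_pi [lie vrepr q, vrepr r].

Lemma sl_scalars_central (A B : sl) : B \in sl_scalars -> [lie A, B] = 0.
Proof.
case/mem_sl_scalars=> a e; apply: val_inj.
by rewrite /= e gl_lieE scalar_mxC subrr.
Qed.

Lemma psl_pi_lie (A B : sl) : psl_pi [lie A, B] = psl_lie (psl_pi A) (psl_pi B).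
Proof.
have modl (A' C : sl) : A' - A \in sl_scalars -> [lie A', C] = [lie A, C].
  move=> h; rewrite -(subrK A A') lieDl lieC (sl_scalars_central _ h).
  by rewrite oppr0 add0r.
have reprP (C : sl) : vrepr (psl_pi C) - C \in sl_scalars.
  by rewrite -vpi_eq vreprK.
rewrite /psl_lie (modl _ _ (reprP A)) -[vrepr (psl_pi B)](subrK B) lieDr.
by rewrite (sl_scalars_central _ (reprP B)) add0r.
Qed.

Fact psl_reprK (q : psl) : psl_pi (vrepr q) = q.
Proof. exact: vreprK. Qed.

Fact psl_lie_linear_l r : linear (psl_lie^~ r).
Proof.
move=> a q q'; rewrite -[q]psl_reprK -[q']psl_reprK -[r]psl_reprK -linearP.
by rewrite -!psl_pi_lie lie_linearl linearP.
Qed.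

Fact psl_lie_linear_r q : linear (psl_lie q).
Proof.
move=> a r r'; rewrite -[q]psl_reprK -[r]psl_reprK -[r']psl_reprK -linearP.
by rewrite -!psl_pi_lie lie_linearr linearP.
Qed.

Fact psl_liexx q : psl_lie q q = 0.
Proof. by rewrite -[q]psl_reprK -psl_pi_lie liexx linear0. Qed.

Fact psl_jacobi q r s :
  psl_lie q (psl_lie r s) + psl_lie r (psl_lie s q) + psl_lie s (psl_lie q r) = 0.
Proof.
rewrite -[q]psl_reprK -[r]psl_reprK -[s]psl_reprK -!psl_pi_lie -!linearD.
by rewrite lie_jacobi linear0.
Qed.

HB.instance Definition _ := Vector_isLie.Build K psl
  psl_lie_linear_l psl_lie_linear_r psl_liexx psl_jacobi.

End Gl.

(* Matrix indices run over 'I_3 = {0, 1, 2}, hence the shift by one.          *)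

Section Elements.
Variable K : fieldType.

Definition E (i j : 'I_3) : gl K 3 := delta_mx i j.

Lemma E_sl_subproof (i j : 'I_3) : i != j -> E i j \in sl_vs K 3.
Proof.
move=> ij; rewrite mem_sl_vs /mxtrace big1 // => k _; rewrite mxE.
by case: eqP => // ->; rewrite (negbTE ij).
Qed.

Definition x1 : sl K 3 := Subvs (@E_sl_subproof 0 1 isT).
Definition x2 : sl K 3 := Subvs (@E_sl_subproof 1 2 isT).
Definition x3 : sl K 3 := [lie x1, x2].
Definition y1 : sl K 3 := Subvs (@E_sl_subproof 1 0 isT).
Definition y2 : sl K 3 := Subvs (@E_sl_subproof 2 1 isT).
Definition y3 : sl K 3 := [lie y1, y2].
Definition h1 : sl K 3 := [lie x1, y1].
Definition h2 : sl K 3 := [lie x2, y2].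

Lemma val_x3 : vsval x3 = E 0 2.
Proof.
rewrite val_sl_lie gl_lieE /= /E mul_delta_mx mul_delta_mx_0 ?subr0 //.
Qed.

Lemma val_y3 : vsval y3 = - E 2 0.
Proof. by rewrite val_sl_lie gl_lieE /= /E mul_delta_mx mul_delta_mx_0 ?sub0r. Qed.

Lemma val_h1 : vsval h1 = E 0 0 - E 1 1.
Proof. by rewrite val_sl_lie gl_lieE /= /E !mul_delta_mx. Qed.

Lemma val_h2 : vsval h2 = E 1 1 - E 2 2.
Proof. by rewrite val_sl_lie gl_lieE /= /E !mul_delta_mx. Qed.

Definition D3 : gl K 3 := E 0 0.

Lemma D3_dual_exists : exists f : 'Hom(gl K 3, K^o),
  (forall A : gl K 3, A \in sl_vs K 3 -> f A = 0) /\ f D3 = 1.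
Proof.
exists (linfun (mxtrace : gl K 3 -> K^o)).
have trE A := lfunE (mxtrace : {linear 'M[K]_3 -> K^o}) A.
split=> [A|]; first by rewrite mem_sl_vs trE => /eqP.
by rewrite trE /= /mxtrace !big_ord_recr big_ord0 !mxE /= !addr0 add0r.
Qed.

Definition psl3_basis : 7.-tuple (psl K 3) :=
  [tuple psl_pi x1; psl_pi x2; psl_pi x3;
         psl_pi y1; psl_pi y2; psl_pi y3; psl_pi h1].

Let comb (k : 'I_7 -> K) : sl K 3 :=
  k 0 *: x1 + k 1 *: x2 + k 2 *: x3 + k 3 *: y1 + k 4 *: y2 + k 5 *: y3 + k 6 *: h1.

Let val_comb k : vsval (comb k) =
  k 0 *: E 0 1 + k 1 *: E 1 2 + k 2 *: E 0 2 + k 3 *: E 1 0 + k 4 *: E 2 1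
  - k 5 *: E 2 0 + k 6 *: (E 0 0 - E 1 1) :> 'M[K]_3.
Proof. by rewrite -scalerN -val_h1 -val_x3 -val_y3. Qed.

Let comb_sum k : \sum_(i < 7) k i *: psl3_basis`_i = psl_pi (comb k).
Proof.
rewrite !big_ord_recr big_ord0 /= add0r /comb !linearD !linearZ /=.
by congr (_ + _ + _ + _ + _ + _ + _); congr (k _ *: _); apply: val_inj.
Qed.

Lemma psl3_basis_free : free psl3_basis.
Proof.
apply/freeP => k; rewrite comb_sum => /eqP.
rewrite -(linear0 (psl_pi (K := K) (n := 3))) vpi_eq subr0.
case/mem_sl_scalars => a; rewrite val_comb => /matrixP e.
move: (e 0 0) (e 0 1) (e 0 2) (e 1 0) (e 1 2) (e 2 0) (e 2 1) (e 2 2).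
rewrite !mxE /= !(mulr0, mulr1, mulr0n, mulr1n, addr0, add0r, subr0, oppr0, sub0r).
move=> k6 k0 k2 k3 k1 /eqP; rewrite oppr_eq0 => /eqP k5 k4 a0.
rewrite -{}a0 in k6; case=> -[|[|[|[|[|[|[|//]]]]]]] lt_i7.
- by rewrite -k0; congr k; apply: val_inj.
- by rewrite -k1; congr k; apply: val_inj.
- by rewrite -k2; congr k; apply: val_inj.
- by rewrite -k3; congr k; apply: val_inj.
- by rewrite -k4; congr k; apply: val_inj.
- by rewrite -k5; congr k; apply: val_inj.
- by rewrite -k6; congr k; apply: val_inj.
Qed.

Lemma psl3_basisP : 3%N \in [pchar K] -> basis_of fullv psl3_basis.
Proof.
move=> /pcharf0 char3; rewrite /basis_of psl3_basis_free andbT eqEsubv subvf /=.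
apply/subvP=> q _; rewrite -[q]psl_reprK; set A := vrepr q.
pose k (i : 'I_7) : K := nth 0 [:: vsval A 0 1; vsval A 1 2; vsval A 0 2;
  vsval A 1 0; vsval A 2 1; - vsval A 2 0; vsval A 0 0 - vsval A 2 2] i.
have -> : psl_pi A = psl_pi (comb k).
  apply/eqP; rewrite vpi_eq; apply/mem_sl_scalars; exists (vsval A 2 2).
  have trA : vsval A 0 0 + vsval A 1 1 + vsval A 2 2 = 0.
    have /eqP <- : \tr (vsval A : 'M[K]_3) == 0 by rewrite -mem_sl_vs subvsP.
    rewrite /mxtrace !big_ord_recr big_ord0 /= add0r.
    by congr (_ + _ + _); congr (vsval A _ _); apply: val_inj.
  have -> : vsval (A - comb k) = vsval A - vsval (comb k) by [].
  have I3 (i : 'I_3) : [\/ i = 0, i = 1 | i = 2].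
    by case: i => -[|[|[|//]]] ?; [apply: Or31 | apply: Or32 | apply: Or33];
      apply: val_inj.
  rewrite val_comb; apply/matrixP => i j.
  case: (I3 i) => ->; case: (I3 j) => ->; rewrite !mxE /k /=.
  all: try ring.
  have -> : vsval A 1 1 = - vsval A 0 0 - vsval A 2 2.
    by apply/eqP; rewrite -subr_eq0 -[X in _ == X]trA; apply/eqP; ring.
  transitivity (vsval A 2 2 - 3%:R * vsval A 2 2); first by ring.
  by rewrite char3 mul0r subr0.
rewrite -comb_sum rpred_sum // => i _; rewrite rpredZ // memv_span //.
by rewrite mem_nth // size_tuple.
Qed.

Definition psl3_dual (i : 'I_7) : 'Hom(psl K 3, K^o) :=
  linfun (coord psl3_basis i : psl K 3 -> K^o).

Lemma psl3_dualE i v : psl3_dual i v = coord psl3_basis i v.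
Proof. exact: (lfunE (coord psl3_basis i : {linear _ -> K^o})). Qed.

Definition x1d := psl3_dual 0.
Definition x2d := psl3_dual 1.
Definition x3d := psl3_dual 2.
Definition y1d := psl3_dual 3.
Definition y2d := psl3_dual 4.
Definition y3d := psl3_dual 5.

(* deg x_1 = deg x_2 = 1 and deg y_1 = deg y_2 = -1 force the other degrees.  *)
Definition psl3_basis_deg : seq int := [:: 1; 1; 2; -1; -1; -2; 0].

Definition psl3_gr (d : int) : {vspace psl K 3} :=
  (\sum_(i < 7 | psl3_basis_deg`_i == d) <[psl3_basis`_i]>)%VS.

Definition derivation_degree (D : 'End(psl K 3)) (d : int) : Prop :=
  forall e v, v \in psl3_gr e -> D v \in psl3_gr (e + d).

(* A cochain has degree d if it is homogeneous of degree d as a map to K,     *)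
(* with K in degree 0; in particular the dual of v has degree - deg v.        *)
Definition cochain_degree (w : bilform (psl K 3)) (d : int) : Prop :=
  forall e e' u v, u \in psl3_gr e -> v \in psl3_gr e' ->
    e + e' + d != 0 -> w u v = 0.

End Elements.

Arguments x1 {K}.
Arguments x2 {K}.
Arguments x3 {K}.
Arguments y1 {K}.
Arguments y2 {K}.
Arguments y3 {K}.
Arguments h1 {K}.
Arguments h2 {K}.
Arguments D3 {K}.
Arguments x1d {K}.
Arguments x2d {K}.
Arguments x3d {K}.
Arguments y1d {K}.
Arguments y2d {K}.
Arguments y3d {K}.
Arguments class1 {K L} D.
Arguments class2 {K L} w.

(* Main.v *)
(* Both H^1(g; g) and H^2(g) are quotients Z / B of finite-dimensional spaces *)
(* which, in the bases at hand, are cut out (for Z) and spanned (for B) by    *)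
(* vectors over the prime field F_3. To show that given vectors of Z          *)
(* represent a basis of Z / B it suffices to know that the coordinates of a   *)
(* vector of Z over the generators of B and the representatives can be read   *)
(* off by explicit linear forms, i.e. that certain linear forms over F_3 are  *)
(* combinations of the equations of Z, and that the representatives are       *)
(* independent modulo B. This is decided by Gaussian elimination over F_3,    *)
(* whose soundness over any field of characteristic 3 is elementary. For      *)
(* gl(3), c_0 is the derivation A |-> - tr(A) 1.                              *)
Require Import Defs.
From HB Require Import structures.
From mathcomp Require Import all_boot all_order all_algebra.
From mathcomp Require Import ring.

Set Implicit Arguments.
Unset Strict Implicit.
Unset Printing Implicit Defensive.

Import GRing.Theory.
Local Open Scope ring_scope.

(** In a basis with structure constants in F_3, derivations and 2-cocycles are the solutions of
    homogeneous linear systems over F_3, while inner derivations and coboundaries are spanned by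
    explicit F_3-vectors. Ranks do not change under field extension, so one elimination over F_3
    settles the matter for every field of characteristic 3.

    Let R list the generators of B followed by the proposed representatives of Z / B. Three finite
    facts suffice: the representatives solve the equations of Z; these equations imply v = sum of
    coef_l(v) R_l for explicit linear forms coef_l; and any relation among the R_l has zero
    coefficients on the representatives. This is [quotient_basis], which rests on [entails_eval],
    the soundness of elimination. The translation into coordinates is [mem_Der_coords],
    [mem_Inn_coords], [mem_Z2_coords] and [mem_B2_coords], packaged as [H1_basis] and [H2_basis].
    The facts themselves are checked by computation, in 81 unknowns for gl(3) and 49 for psl(3).

    For gl(3), c_0 sends A to - tr(A) 1. It is a derivation because it kills commutators and has
    central values; it is outer because c_0(E_11) = -1, whereas [a, E_11] has zero diagonal. For
    psl(3), brackets are computed in sl(3) and reduced modulo scalars, and degrees are read off the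
    positions of the nonzero entries. *)

(* The prime field F_3, with None = 0 and Some b = (-1)^b. *)
Definition trit := option bool.

Definition tadd (a b : trit) : trit :=
  match a, b with
  | None, _ => b
  | _, None => a
  | Some x, Some y => if x == y then Some (~~ x) else None
  end.

Definition topp (a : trit) : trit := omap negb a.

Definition tmul (a b : trit) : trit :=
  match a, b with
  | Some x, Some y => Some (x (+) y)
  | _, _ => None
  end.

Definition tsum (n : nat) (F : nat -> trit) : trit :=
  foldr (fun i => tadd (F i)) None (iota 0 n).

(** * Linear forms and Gaussian elimination over F_3 *)

(* A linear form over F_3 (equivalently, a vector), with the coefficients     *)
(* beyond the end of the list equal to 0. *)
Definition form := seq trit.

Definition fscale (c : trit) (f : form) : form :=
  if c is None then [::] else map (tmul c) f.

Definition fopp (f : form) : form := map topp f.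

Fixpoint fadd (f g : form) : form :=
  match f, g with
  | [::], _ => g
  | _, [::] => f
  | a :: f', b :: g' => tadd a b :: fadd f' g'
  end.

Definition fvar (i : nat) : form := ncons i None [:: Some false].

Definition fsum (n : nat) (F : nat -> form) : form :=
  foldr (fun i => fadd (F i)) [::] (iota 0 n).

(* A triangular system of linear equations: the i-th entry is None, or Some t *)
(* for the equation v_i + t (v_(i+1), v_(i+2), ...) = 0. *)
Definition system := seq (option form).

(** One elimination step. A nonzero trit is its own inverse, so multiplying by the leading
    coefficient [c] makes a new pivot equal to 1; against an existing pivot, [c] times its row is
    subtracted. What remains of a form past the end of the system is dropped, which only weakens the
    system. *)
Fixpoint insert (T : system) (g : form) : system :=
  match g, T with
  | None :: g', o :: T' => o :: insert T' g'
  | c :: g', None :: T' => Some (fscale c g') :: T'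
  | c :: g', Some t :: T' => Some t :: insert T' (fadd g' (fscale (topp c) t))
  | _, _ => T
  end.

Fixpoint reduces (T : system) (g : form) : bool :=
  match g, T with
  | [::], _ => true
  | None :: g', _ :: T' => reduces T' g'
  | c :: g', Some t :: T' => reduces T' (fadd g' (fscale (topp c) t))
  | _, _ => false
  end.

(** Elimination starts from [N] unconstrained unknowns; a form that the pivots reduce to zero is a
    combination of [eqs]. *)
Definition entails (N : nat) (eqs gs : seq form) : bool :=
  let T := foldl insert (nseq N None) eqs in all (reduces T) gs.

(** * Soundness of elimination over a field of characteristic 3 *)

Section Evaluation.
Variables (K : fieldType) (charK : 3%N \in [pchar K]).
Implicit Types (a b : trit) (f g : form) (v : nat -> K) (T : system).

Definition tval a : K := if a is Some x then (-1) ^+ x else 0.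

Lemma two_pchar3 : 2 = -1 :> K.
Proof.
apply/eqP; rewrite -subr_eq0 opprK -[X in _ + X]/(1%:R) -natrD.
by rewrite (pcharf0 charK).
Qed.

Lemma tval_add a b : tval (tadd a b) = tval a + tval b.
Proof.
have e : (1 + 1 : K) = -1 by exact: two_pchar3.
case: a b => [[]|] [[]|] //=; rewrite ?expr1 ?expr0 ?addr0 ?add0r ?subrr ?addNr //.
by rewrite -opprD e opprK.
Qed.

Lemma tval_opp a : tval (topp a) = - tval a.
Proof. by case: a => [[]|] //=; rewrite ?expr1 ?expr0 ?opprK ?oppr0. Qed.

Lemma tval_mul a b : tval (tmul a b) = tval a * tval b.
Proof.
by case: a b => [[]|] [[]|] //=;
  rewrite ?expr1 ?expr0 ?mul0r ?mulr0 ?mul1r ?mulr1 ?mulN1r ?opprK.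
Qed.

Lemma tval_sum n (F : nat -> trit) :
  tval (tsum n F) = \sum_(i < n) tval (F i).
Proof.
rewrite -(big_mkord xpredT (tval \o F)) /index_iota subn0 /tsum.
by elim: (iota 0 n) => [|i s IH] /=; rewrite ?big_nil // big_cons tval_add IH.
Qed.

Lemma tval_sqr_id a : a != None -> tval a * tval a = 1.
Proof. by case: a => // x _; rewrite /= -expr2 sqrr_sign. Qed.

Fixpoint eval f v : K :=
  if f is c :: f' then tval c * v 0%N + eval f' (v \o succn) else 0.

Lemma eval_add f g v : eval (fadd f g) v = eval f v + eval g v.
Proof.
elim: f g v => [|a f IH] [|b g] v /=; rewrite ?add0r ?addr0 //.
by rewrite IH tval_add mulrDl addrACA.
Qed.

Lemma eval_scale c f v : eval (fscale c f) v = tval c * eval f v.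
Proof.
case: c => [x|]; last by rewrite mul0r.
rewrite /fscale; move: (Some x) => c; elim: f v => [|a f IH] v /=.
  by rewrite mulr0.
by rewrite IH tval_mul mulrDr mulrA.
Qed.

Lemma eval_opp f v : eval (fopp f) v = - eval f v.
Proof.
elim: f v => [|a f IH] v /=; first by rewrite oppr0.
by rewrite IH tval_opp mulNr opprD.
Qed.

Lemma eval_var i v : eval (fvar i) v = v i.
Proof.
rewrite /fvar; elim: i v => [|i IH] v /=; first by rewrite mul1r addr0.
by rewrite mul0r add0r IH.
Qed.

Lemma eval_sum n (F : nat -> form) v :
  eval (fsum n F) v = \sum_(i < n) eval (F i) v.
Proof.
rewrite -(big_mkord xpredT (fun i => eval (F i) v)) /index_iota subn0 /fsum.
by elim: (iota 0 n) => [|i s IH] /=; rewrite ?big_nil // big_cons eval_add IH.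
Qed.

Lemma eval_ext f v v' : v =1 v' -> eval f v = eval f v'.
Proof.
by elim: f v v' => //= c f IH v v' e; rewrite e (IH _ (v' \o succn)) // => i /=.
Qed.

Fixpoint solves T v : Prop :=
  if T is o :: T' then
    (if o is Some t then v 0%N + eval t (v \o succn) = 0 else True)
    /\ solves T' (v \o succn)
  else True.

Lemma insert_solves T g v : solves T v -> eval g v = 0 -> solves (insert T g) v.
Proof.
elim: T g v => [|o T IH] [|[x|] g] v //= [ho hT].
  2: by rewrite mul0r add0r => h; split=> //; apply: IH.
case: o ho => [t|] ho h; split => //.
  apply: IH => //; rewrite eval_add (eval_scale (topp (Some x))) (tval_opp (Some x)).
  move: ho h => /eqP; rewrite addr_eq0 => /eqP -> h.
  by rewrite mulNr addrC -mulrN.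
(* New pivot: the leading sign squares to 1, so the normalized equation is the old one times that
   sign. *)
rewrite -[map _ _]/(fscale (Some x) g) eval_scale.
rewrite -[v 0%N]mul1r -(@tval_sqr_id (Some x)) // -mulrA -mulrDr.
by rewrite [X in _ * X]h mulr0.
Qed.

Lemma reduces_eval T g v : solves T v -> reduces T g -> eval g v = 0.
Proof.
elim: T g v => [|o T IH] [|[x|] g] v //= [ho hT].
  2: by rewrite mul0r add0r => h; apply: IH hT _.
case: o ho => //= t ho /(IH _ _ hT).
rewrite eval_add (eval_scale (topp (Some x))) (tval_opp (Some x)).
move: ho => /eqP; rewrite addr_eq0 => /eqP -> h.
by rewrite mulrN -mulNr addrC.
Qed.

(** Insertion keeps every common zero of the equations, and reduction changes a form only by
    quantities vanishing there. The point [v] may have arbitrary coordinates in [K]; this is where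
    F_3 computations become statements over [K]. *)
Lemma entails_eval N eqs gs v :
    entails N eqs gs -> (forall e, e \in eqs -> eval e v = 0) ->
  forall g, g \in gs -> eval g v = 0.
Proof.
move=> /allP ent heqs g /ent; apply: reduces_eval.
(* Every point solves the empty system; the induction then generalizes over the system built so
   far. *)
have : solves (nseq N None) v by elim: N v {ent heqs} => //= N IH v; split.
elim: eqs heqs (nseq N None) {ent} => //= e eqs IH heqs T hT.
apply: IH => [f fe|]; first by apply: heqs; rewrite inE fe orbT.
by apply: insert_solves => //; apply: heqs; rewrite inE eqxx.
Qed.

Lemma nth_fadd f g i : nth None (fadd f g) i = tadd (nth None f i) (nth None g i).
Proof.
elim: f g i => [|a f IH] [|b g] [|i] //=.
- by case: a.
- by case: (nth _ _ _).
Qed.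

Lemma nth_fopp f i : nth None (fopp f) i = topp (nth None f i).
Proof. by elim: f i => [|a f IH] [|i] /=. Qed.

Lemma nth_fvar i j : nth None (fvar i) j = if j == i then Some false else None.
Proof.
rewrite /fvar nth_ncons; have [ltji|leij] := ltnP j i; first by rewrite ltn_eqF.
by case: (j - i)%N (subnK leij) => [|k] <- /=;
  rewrite ?add0n ?eqxx // nth_nil addSn gtn_eqF // ltnS leq_addl.
Qed.

Definition dot (f g : form) : trit :=
  foldr (fun p => tadd (tmul p.1 p.2)) None (zip f g).

(** At a point with coordinates in F_3 evaluation stays in F_3, where [dot] computes it. *)
Lemma eval_tval f g :
  eval f (fun i => tval (nth None g i)) = tval (dot f g).
Proof.
rewrite /dot; elim: f g => [|a f IH] [|b g] //=.
  rewrite mulr0 add0r; elim: {IH} f => //= c f IH; rewrite mulr0 add0r //.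
by rewrite tval_add tval_mul -IH.
Qed.

End Evaluation.

(** The p-th coordinate of the sum of the F_l R_l, as a form in the unknowns of the F_l. *)
Definition comb (R : seq form) (p : nat) (F : nat -> form) : form :=
  fsum (size R) (fun l => fscale (nth None (nth [::] R l) p) (F l)).

(* [eqs] are the equations of Z, [gens] span B and [outs] represent a basis   *)
(* of Z / B; [coefs] are the linear forms giving the coordinates of a         *)
(* solution of [eqs] in terms of [gens ++ outs]. *)
Definition quotient_basis_check (N : nat) (eqs gens outs coefs : seq form) :=
  let R := gens ++ outs in
  let n := size gens in
  [&& all (fun e => all (fun o => dot e o == None) outs) eqs,
      all (fun o => size o <= N)%N outs,
      entails N eqs
        (mkseq (fun p => fadd (fvar p) (fopp (comb R p (nth [::] coefs)))) N) &
      entails (size R) (mkseq (fun p => comb R p fvar) N)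
        (mkseq (fun m => fvar (n + m)) (size outs))].

(** * A basis of Z / B from a finite check *)

Section QuotientBasis.
Variables (K : fieldType) (charK : 3%N \in [pchar K]).
Variables (V : vectType K) (Z B : {vspace V}).
Variables (N : nat) (phi : V -> nat -> K).
Variables (eqs gens outs coefs : seq form) (Ds : seq V).

Local Notation val_nth f p := (tval K (nth None f p)).

Hypothesis phi_linear : forall a u v p, phi (a *: u + v) p = a * phi u p + phi v p.
Hypothesis phi_large : forall v p, (N <= p)%N -> phi v p = 0.
Hypothesis memZ :
  forall v, v \in Z <-> forall e, e \in eqs -> eval e (phi v) = 0.
Hypothesis memB :
  forall v, v \in B <-> exists a : nat -> K, forall p, (p < N)%N ->
    phi v p = \sum_(l < size gens) val_nth (nth [::] gens l) p * a l.
Hypothesis size_outs : size Ds = size outs.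
Hypothesis phi_outs : forall m p, (m < size outs)%N -> (p < N)%N ->
  phi (nth 0 Ds m) p = val_nth (nth [::] outs m) p.
Hypothesis check : quotient_basis_check N eqs gens outs coefs.

Let eval_comb p F v : eval (comb (gens ++ outs) p F) v =
  \sum_(l < size gens) val_nth (nth [::] gens l) p * eval (F l) v
  + \sum_(m < size outs)
      val_nth (nth [::] outs m) p * eval (F (size gens + m)%N) v.
Proof.
rewrite /comb (eval_sum charK) size_cat big_split_ord; congr (_ + _).
  by apply: eq_bigr => l _; rewrite eval_scale nth_cat /= ltn_ord.
apply: eq_bigr => m _.
by rewrite eval_scale nth_cat /= ltnNge leq_addr /= addKn.
Qed.

Let phi_comb (t : nat -> K) v p :
  phi (v + \sum_(m < size outs) t m *: nth 0 Ds m) p =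
  phi v p + \sum_(m < size outs) t m * phi (nth 0 Ds m) p.
Proof.
elim: (size outs) => [|k IH]; first by rewrite !big_ord0 !addr0.
rewrite !big_ord_recr /= addrA [X in phi X]addrC phi_linear IH.
by rewrite addrCA; congr (_ + _); apply: addrC.
Qed.

Let phi0 p : phi 0 p = 0.
Proof.
by apply: (addrI (phi 0 p)); rewrite -{1}[phi 0 p]mul1r -phi_linear !addr0 scaler0.
Qed.

Lemma quotient_basis_mem D : D \in Ds -> D \in Z.
Proof.
case/and4P: check => dot0 /allP le_outs _ _ /(nthP 0)[m ltm <-].
rewrite size_outs in ltm; apply/memZ => e ee.
have oo : nth [::] outs m \in outs by rewrite mem_nth.
rewrite (@eval_ext _ _ _ (fun i => tval K (nth None (nth [::] outs m) i))).
  move: (allP (allP dot0 e ee) _ oo); rewrite (eval_tval charK) => /eqP -> //.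
(* Below [N] the coordinates agree with the F_3-vector by hypothesis; from [N] on both are zero. *)
move=> p; have [ltp|lep] := ltnP p N; first exact: phi_outs.
by rewrite phi_large // nth_default // (leq_trans (le_outs _ oo)).
Qed.

(** Spanning: a solution of the equations is a combination of generators and representatives, hence
    congruent modulo [B] to a combination of representatives. Independence: a combination of
    representatives lying in [B] is a relation among generators and representatives, whose
    coefficients on the latter must vanish. The generators may be linearly dependent. *)
Lemma quotient_basis :
  basis_of (linfun (vpi B) @: Z)%VS (map (vpi B) Ds).
Proof.
case/and4P: check => _ _ span indep.
rewrite /basis_of eqEsubv -andbA; apply/and3P; split.
- apply/span_subvP => _ /mapP[D DD ->]; apply/memv_imgP.
  by exists D; rewrite ?lfunE ?quotient_basis_mem.
- apply/subvP => _ /memv_imgP[v vZ ->]; rewrite lfunE /=.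
  (* [t] holds the coordinates read off by [coefs]; adding [w] removes the part along the
     representatives and leaves the combination of generators with coefficients [t]. *)
  pose t l : K := eval (nth [::] coefs l) (phi v).
  pose w := \sum_(m < size outs) - t (size gens + m)%N *: nth 0 Ds m.
  have vwB : v + w \in B.
    apply/memB; exists t => p ltp; rewrite (phi_comb (fun m => - t (size gens + m)%N)).
    have /(entails_eval charK span (proj1 (memZ v) vZ)) :
        fadd (fvar p) (fopp (comb (gens ++ outs) p (nth [::] coefs)))
          \in mkseq (fun p => fadd (fvar p)
                (fopp (comb (gens ++ outs) p (nth [::] coefs)))) N.
      by apply/mapP; exists p; rewrite // mem_iota.
    rewrite (eval_add charK) eval_var eval_opp eval_comb opprD addrA.
    rewrite addrAC => /eqP; rewrite subr_eq0 => /eqP <-; congr (_ + _).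
    by rewrite -sumrN; apply: eq_bigr => m _; rewrite phi_outs // mulNr mulrC.
  have -> : vpi B v = vpi B (- w) by apply/eqP; rewrite vpi_eq opprK.
  rewrite /w -sumrN linear_sum rpred_sum // => m _.
  rewrite -scaleNr linearZ rpredZ // memv_span // map_f // mem_nth //.
  by rewrite size_outs.
apply/(@freeP _ _ _ (in_tuple (map (vpi B) Ds))) => k.
have szk : size (map (vpi B) Ds) = size outs by rewrite size_map.
pose t m : K := if insub m is Some i then k i else 0.
have tE i : t (val i) = k i by rewrite /t valK.
have -> : \sum_(i < size (map (vpi B) Ds)) k i *: (in_tuple (map (vpi B) Ds))`_i
    = vpi B (0 + \sum_(m < size outs) t m *: nth 0 Ds m).
  rewrite add0r linear_sum -(big_mkord xpredT (fun m => vpi B (t m *: nth 0 Ds m))).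
  rewrite -szk big_mkord; apply: eq_bigr => i _ /=.
  by rewrite linearZ tE (nth_map 0) // -(size_map (vpi B)).
move/eqP; rewrite -(linear0 (vpi B)) vpi_eq subr0 => /memB[a ha] i.
(* The relation: [a] on the generators, then the opposite of [t] on the representatives. *)
pose s l := if (l < size gens)%N then a l else - t (l - size gens)%N.
rewrite -tE; apply/eqP; rewrite -oppr_eq0; apply/eqP.
have -> : - t i = s (size gens + i)%N by rewrite /s ltnNge leq_addr /= addKn.
rewrite -eval_var; apply: (entails_eval charK indep).
  move=> _ /mapP[p ltp ->]; rewrite mem_iota /= add0n in ltp.
  have {ha} := ha p ltp; rewrite phi_comb phi0 add0r eval_comb => ha.
  rewrite (eq_bigr (fun l : 'I__ => val_nth (nth [::] gens l) p * a l)) => [|l _].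
    rewrite -ha -big_split big1 // => m _ /=.
    by rewrite eval_var /s ltnNge leq_addr /= addKn phi_outs // mulrN mulrC subrr.
  by rewrite eval_var /s ltn_ord.
by apply/mapP; exists (val i); rewrite // mem_iota /= add0n -szk.
Qed.

End QuotientBasis.

(** * Derivations and 2-cocycles of a Lie algebra in coordinates *)

Definition cube (n : nat) (F : nat -> nat -> nat -> form) : seq form :=
  [seq F ij.1 ij.2 k | ij <- [seq (i, j) | i <- iota 0 n, j <- iota 0 n],
                       k <- iota 0 n].

Lemma cubeP n (F : nat -> nat -> nat -> form) (P : form -> Prop) :
  (forall e, e \in cube n F -> P e) <->
  (forall i j k, (i < n)%N -> (j < n)%N -> (k < n)%N -> P (F i j k)).
Proof.
split=> [h i j k lti ltj ltk | h e].
  apply/h/allpairsP; exists ((i, j), k); split; rewrite ?mem_iota //.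
  by apply/allpairsP; exists (i, j); split; rewrite ?mem_iota.
case/allpairsP=> -[ij k] /= [/allpairsP[[i j] /= [iin jin ->]] kin ->].
by rewrite !mem_iota in iin jin kin; apply: h.
Qed.

Section Tables.
Variables (n : nat) (c : nat -> nat -> nat -> trit).

(* A linear map D is stored as the vector whose entry k * n + j is the k-th   *)
(* coordinate of D (b_j), a bilinear form w as the vector whose entry         *)
(* i * n + j is w (b_i) (b_j). *)
Definition derivation_eq (i j k : nat) : form :=
  fadd (fsum n (fun l => fscale (c i j l) (fvar (k * n + l))))
       (fopp (fadd (fsum n (fun l => fscale (c l j k) (fvar (l * n + i))))
                   (fsum n (fun l => fscale (c i l k) (fvar (l * n + j)))))).

Definition derivation_eqs : seq form := cube n derivation_eq.

(** The l-th vector is the matrix of ad b_l. *)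
Definition inner_gens : seq form :=
  mkseq (fun l => mkseq (fun p => c l (p %% n) (p %/ n)) (n * n)) n.

(** For i = j this reads 2 w(b_i, b_i) = 0, so alternation is encoded as well. *)
Definition antisymmetry_eq (i j k : nat) : form :=
  fadd (fvar (i * n + j)) (fvar (j * n + i)).

Definition cocycle_eq (i j k : nat) : form :=
  fadd (fadd (fopp (fsum n (fun l => fscale (c i j l) (fvar (l * n + k)))))
             (fsum n (fun l => fscale (c i k l) (fvar (l * n + j)))))
       (fopp (fsum n (fun l => fscale (c j k l) (fvar (l * n + i))))).

Definition cocycle_eqs : seq form := cube n antisymmetry_eq ++ cube n cocycle_eq.

(** The l-th vector is the differential, with the sign of [ce_d1], of the functional dual to b_l. *)
Definition coboundary_gens : seq form :=
  mkseq (fun l => mkseq (fun p => topp (c (p %/ n) (p %% n) l)) (n * n)) n.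

End Tables.

Section LieCoordinates.
Variables (K : fieldType) (charK : 3%N \in [pchar K]) (L : lieAlgType K).
Variables (n : nat) (b : nat -> L) (co : nat -> L -> K).
Variable c : nat -> nat -> nat -> trit.

Hypothesis co_linear : forall k a u v, co k (a *: u + v) = a * co k u + co k v.
Hypothesis co_b : forall k j, (k < n)%N -> (j < n)%N -> co k (b j) = (k == j)%:R.
Hypothesis co_sum : forall x, x = \sum_(k < n) co k x *: b k.
Hypothesis co_lie : forall i j k, (i < n)%N -> (j < n)%N -> (k < n)%N ->
  co k [lie b i, b j] = tval K (c i j k).

Definition tabulate (F : nat -> nat -> K) (p : nat) : K :=
  if (p < n * n)%N then F (p %/ n)%N (p %% n)%N else 0.

Lemma ltn_index m i j : (i < m)%N -> (j < m)%N -> (i * m + j < m * m)%N.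
Proof.
move=> lti ltj; rewrite (leq_trans (n := i.+1 * m)) ?leq_mul2r ?lti ?orbT //.
by rewrite mulSn addnC ltn_add2r.
Qed.

Lemma tabulateE F i j : (i < n)%N -> (j < n)%N -> tabulate F (i * n + j) = F i j.
Proof.
move=> lti ltj; have n0 : (0 < n)%N by apply: leq_ltn_trans lti.
rewrite /tabulate divnMDl // divn_small // addn0 modnMDl modn_small //.
by rewrite ifT // ltn_index.
Qed.

Lemma tabulate_large F p : (n * n <= p)%N -> tabulate F p = 0.
Proof. by rewrite /tabulate ltnNge => ->. Qed.

Lemma ltn_divmod p : (p < n * n)%N -> (p %/ n < n)%N /\ (p %% n < n)%N.
Proof.
by case: n => // m ltp; rewrite ltn_divLR // ltn_mod.
Qed.

Definition end_coords (D : 'End(L)) := tabulate (fun k j => co k (D (b j))).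
Definition form_coords (w : bilform L) := tabulate (fun i j => w (b i) (b j)).

Lemma end_coords_linear a D D' p :
  end_coords (a *: D + D') p = a * end_coords D p + end_coords D' p.
Proof.
rewrite /end_coords /tabulate; case: ifP => _; last by rewrite mulr0 addr0.
by rewrite add_lfunE scale_lfunE co_linear.
Qed.

Lemma form_coords_linear a w w' p :
  form_coords (a *: w + w') p = a * form_coords w p + form_coords w' p.
Proof.
rewrite /form_coords /tabulate; case: ifP => _; last by rewrite mulr0 addr0.
by rewrite !(add_lfunE, scale_lfunE).
Qed.

Lemma co0 k : co k 0 = 0.
Proof.
by apply: (addrI (co k 0)); rewrite -{1}[co k 0]mul1r -co_linear scaler0 !addr0.
Qed.

Lemma coZ k a x : co k (a *: x) = a * co k x.
Proof. by rewrite -[a *: x]addr0 co_linear co0 addr0. Qed.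

Lemma coN k x : co k (- x) = - co k x.
Proof. by rewrite -scaleN1r coZ mulN1r. Qed.

Lemma coD k x y : co k (x + y) = co k x + co k y.
Proof. by rewrite -[x]scale1r co_linear mul1r scale1r. Qed.

Lemma co_lincomb k m (t : 'I_m -> K) (u : 'I_m -> L) :
  co k (\sum_(l < m) t l *: u l) = \sum_(l < m) t l * co k (u l).
Proof.
by rewrite (big_morph _ (coD k) (co0 k)); apply: eq_bigr => l _; rewrite coZ.
Qed.

Lemma lie_suml m (t : 'I_m -> K) (u : 'I_m -> L) y :
  [lie \sum_(l < m) t l *: u l, y] = \sum_(l < m) t l *: [lie u l, y].
Proof.
rewrite (big_morph (fun x => [lie x, y]) (fun x z => lieDl x z y) (lie0l y)).
by apply: eq_bigr => l _; rewrite lieZl.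
Qed.

Lemma lie_sumr m (t : 'I_m -> K) (u : 'I_m -> L) y :
  [lie y, \sum_(l < m) t l *: u l] = \sum_(l < m) t l *: [lie y, u l].
Proof. by rewrite linear_sum; apply: eq_bigr => l _; rewrite linearZ. Qed.

Lemma lie_b i j : (i < n)%N -> (j < n)%N ->
  [lie b i, b j] = \sum_(l < n) tval K (c i j l) *: b l.
Proof.
by move=> lti ltj; rewrite [LHS]co_sum; apply: eq_bigr => l _; rewrite co_lie.
Qed.

(** The b_k span, by [co_sum]. Multilinear identities are reduced to basis vectors by applying this
    to one argument at a time. *)
Lemma basis_ext (W : lmodType K) (F : L -> W) :
  (forall a u v, F (a *: u + v) = a *: F u + F v) ->
  (forall i, (i < n)%N -> F (b i) = 0) -> forall x, F x = 0.
Proof.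
move=> Flin Fb x.
have F0 : F 0 = 0.
  by apply: (addrI (F 0)); rewrite -{1}[F 0]scale1r -Flin scaler0 !addr0.
rewrite (co_sum x); apply: (big_ind (fun y => F y = 0)) => // [y z Fy Fz|i _].
  by rewrite -[y]scale1r Flin Fy Fz scaler0 addr0.
by rewrite -[_ *: _]addr0 Flin Fb // scaler0 add0r.
Qed.

Lemma eval_derivation_eq D i j k : (i < n)%N -> (j < n)%N -> (k < n)%N ->
  eval (derivation_eq n c i j k) (end_coords D) =
  co k (D [lie b i, b j] - ([lie D (b i), b j] + [lie b i, D (b j)])).
Proof.
move=> lti ltj ltk; rewrite /derivation_eq !(eval_add charK, eval_opp, eval_sum charK).
rewrite coD coN coD; congr (_ - (_ + _)).
- have -> : D [lie b i, b j] = \sum_(l < n) tval K (c i j l) *: D (b l).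
    by rewrite lie_b // linear_sum; apply: eq_bigr => l _; rewrite linearZ.
  rewrite co_lincomb; apply: eq_bigr => l _.
  by rewrite eval_scale eval_var /end_coords tabulateE.
- rewrite {1}(co_sum (D (b i))) lie_suml co_lincomb.
  apply: eq_bigr => l _.
  by rewrite eval_scale eval_var /end_coords tabulateE // mulrC co_lie.
rewrite {1}(co_sum (D (b j))) lie_sumr co_lincomb.
apply: eq_bigr => l _.
by rewrite eval_scale eval_var /end_coords tabulateE // mulrC co_lie.
Qed.

Lemma mem_Der_coords D : D \in Der L <->
  forall e, e \in derivation_eqs n c -> eval e (end_coords D) = 0.
Proof.
rewrite cubeP; split=> [/memDer derD i j k lti ltj ltk|h].
  by rewrite eval_derivation_eq // derD subrr co0.
apply/memDer => x y; apply/eqP; rewrite -subr_eq0; apply/eqP; move: y.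
apply: basis_ext => [a u v|j ltj].
  rewrite !(linearP, lie_linearr) scalerBr scalerDr [RHS]addrACA -opprD.
  by rewrite [in RHS]addrACA.
move: x; apply: basis_ext => [a u v|i lti].
  rewrite !(linearP, lie_linearl) scalerBr scalerDr [RHS]addrACA -opprD.
  by rewrite [in RHS]addrACA.
rewrite [LHS]co_sum big1 // => k _.
by rewrite -eval_derivation_eq // h // scale0r.
Qed.

(** The coefficients [a] are the coordinates of an element whose adjoint map is [D]. *)
Lemma mem_Inn_coords D : D \in Inn L <-> exists a : nat -> K,
  forall p, (p < n * n)%N -> end_coords D p =
  \sum_(l < size (inner_gens n c)) tval K (nth None (nth [::] (inner_gens n c) l) p) * a l.
Proof.
have gensE (a : nat -> K) p : (p < n * n)%N ->
    \sum_(l < size (inner_gens n c))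
      tval K (nth None (nth [::] (inner_gens n c) l) p) * a l
    = co (p %/ n)%N [lie \sum_(l < n) a l *: b l, b (p %% n)%N].
  move=> ltp; have [ltk ltj] := ltn_divmod ltp.
  rewrite lie_suml co_lincomb size_mkseq.
  by apply: eq_bigr => l _; rewrite !nth_mkseq // co_lie // mulrC.
split=> [/memInn[a aD]|[a h]].
  exists (co^~ a) => p ltp; rewrite (gensE (co^~ a)) // -co_sum /end_coords /tabulate ltp.
  by rewrite aD.
apply/memInn; exists (\sum_(l < n) a l *: b l) => x.
apply/eqP; rewrite -subr_eq0; apply/eqP; move: x.
apply: basis_ext => [d u v|j ltj].
  by rewrite !(linearP, lie_linearr) /= scalerDr [LHS]addrACA.
rewrite [LHS]co_sum big1 // => k _; rewrite coD coN.
have ltp : (k * n + j < n * n)%N by apply: ltn_index.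
have n0 : (0 < n)%N by apply: leq_ltn_trans ltj.
have := h _ ltp; rewrite (gensE a) // /end_coords tabulateE // => ->.
by rewrite divnMDl // divn_small // addn0 modnMDl modn_small // subrr scale0r.
Qed.

Lemma eval_cocycle_eq w i j k : (i < n)%N -> (j < n)%N -> (k < n)%N ->
  eval (cocycle_eq n c i j k) (form_coords w) = ce_d2 w (b i) (b j) (b k).
Proof.
move=> lti ltj ltk; rewrite /cocycle_eq !(eval_add charK, eval_opp, eval_sum charK).
have wE p q r : (p < n)%N -> (q < n)%N -> (r < n)%N ->
    \sum_(l < n) eval (fscale (c p q l) (fvar (l * n + r))) (form_coords w)
    = w [lie b p, b q] (b r).
  move=> ltp ltq ltr; rewrite lie_b // linear_sum sum_lfunE.
  apply: eq_bigr => l _; rewrite linearZ scale_lfunE eval_scale eval_var.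
  by rewrite /form_coords tabulateE.
by rewrite !wE.
Qed.

(** Polarization makes an alternating form antisymmetric; conversely antisymmetry gives 2 w(x, x) =
    0, and 2 = -1 in [K]. The cocycle identity is trilinear, so basis vectors suffice. *)
Lemma mem_Z2_coords w : w \in Z2 L <->
  forall e, e \in cocycle_eqs n c -> eval e (form_coords w) = 0.
Proof.
split=> [/memZ2[alt cocy] e|h].
  have asym x y : w x y + w y x = 0.
    have := alt (x + y); rewrite linearD /= [w (x + y)]linearD /= !add_lfunE. 
    by rewrite !alt add0r addr0 addrC.
  rewrite mem_cat => /orP[]; move: e; apply/cubeP => i j k lti ltj ltk.
    by rewrite (eval_add charK) !eval_var /form_coords !tabulateE.
  by rewrite eval_cocycle_eq.
pose P e := eval e (form_coords w) = 0.
have /(cubeP _ _ P) asymb e : e \in cube n (antisymmetry_eq n) -> P e.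
  by move=> he; apply: h; rewrite mem_cat he.
have /(cubeP _ _ P) cocy e : e \in cube n (cocycle_eq n c) -> P e.
  by move=> he; apply: h; rewrite mem_cat he orbT.
have asym x y : w x y + w y x = 0.
  move: y; apply: (@basis_ext K^o) => [a u v|j ltj].
    by rewrite !linearP add_lfunE scale_lfunE addrACA -scalerDr.
  move: x; apply: (@basis_ext K^o) => [a u v|i lti].
    by rewrite !linearP add_lfunE scale_lfunE addrACA -scalerDr.
  have := asymb i j i lti ltj lti.
  by rewrite /P (eval_add charK) !eval_var /form_coords !tabulateE.
apply/memZ2; split=> [x|x y z].
  have /eqP := asym x x; rewrite -mulr2n -mulr_natl (two_pchar3 charK) mulN1r.
  by rewrite oppr_eq0 => /eqP.
(* The linearity of the expression [ce_d2] in one argument, shared by the three reductions below. *)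
have lin3 (a : K) (p q r p' q' r' : K^o) :
    - (a *: p + p') + (a *: q + q') - (a *: r + r')
    = a *: (- p + q - r) + (- p' + q' - r').
  by rewrite -![a *: _]/(a * _ : K); ring.
have wl a u v t : w (a *: u + v) t = a *: w u t + w v t.
  by rewrite linearP add_lfunE scale_lfunE.
have wr a u v t : w t (a *: u + v) = a *: w t u + w t v by rewrite linearP.
rewrite /ce_d2; move: z; apply: (@basis_ext K^o) => [a u v|k ltk].
  by rewrite !(lie_linearr, wl, wr) lin3.
move: y; apply: (@basis_ext K^o) => [a u v|j ltj].
  by rewrite !(lie_linearr, lie_linearl, wl, wr) lin3.
move: x; apply: (@basis_ext K^o) => [a u v|i lti].
  by rewrite !(lie_linearl, wl, wr) lin3.
rewrite -[LHS]/(ce_d2 w (b i) (b j) (b k)) -eval_cocycle_eq //.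
exact: cocy.
Qed.

(** A coboundary depends only on the values of [f] on the basis. Conversely, by the duality [co_b],
    any values [a] are taken by the functional [f0]. *)
Lemma mem_B2_coords w : w \in B2 L <-> exists a : nat -> K,
  forall p, (p < n * n)%N -> form_coords w p =
  \sum_(l < size (coboundary_gens n c))
    tval K (nth None (nth [::] (coboundary_gens n c) l) p) * a l.
Proof.
have gensE (f : 'Hom(L, K^o)) p : (p < n * n)%N ->
    \sum_(l < size (coboundary_gens n c))
      tval K (nth None (nth [::] (coboundary_gens n c) l) p) * f (b l)
    = ce_d1 f (b (p %/ n)) (b (p %% n)).
  move=> ltp; have [ltk ltj] := ltn_divmod ltp.
  rewrite /ce_d1 lie_b // linear_sum -sumrN size_mkseq.
  by apply: eq_bigr => l _; rewrite !nth_mkseq // tval_opp linearZ mulNr.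
split=> [/memB2[f fw]|[a h]].
  exists (fun l => f (b l)) => p ltp; rewrite gensE //.
  by rewrite /form_coords /tabulate ltp fw.
pose f0 (x : L) : K^o := \sum_(l < n) a l * co l x.
have f0_lin : linear f0.
  move=> d u v; rewrite /f0 scaler_sumr -big_split; apply: eq_bigr => l _ /=.
  by rewrite co_linear mulrDr -[d *: _]/(d * _) mulrCA.
pose f : 'Hom(L, K^o) :=
  linfun (HB.pack f0 (GRing.isLinear.Build K L K^o _ f0 f0_lin) : {linear L -> K^o}).
have fE x : f x = f0 x by rewrite lfunE.
have fb j : (j < n)%N -> f (b j) = a j.
  move=> ltj; rewrite fE /f0 (bigD1 (Ordinal ltj)) //= co_b // eqxx mulr1.
  rewrite big1 ?addr0 // => l ne; rewrite co_b // -val_eqE in ne *.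
  by rewrite (negbTE ne) mulr0.
have wf i j : (i < n)%N -> (j < n)%N -> w (b i) (b j) = ce_d1 f (b i) (b j).
  move=> lti ltj; have n0 : (0 < n)%N by apply: leq_ltn_trans ltj.
  have ltp := ltn_index lti ltj.
  have := gensE f _ ltp; rewrite divnMDl // divn_small // addn0 modnMDl modn_small //.
  move=> <-; have := h _ ltp; rewrite /form_coords tabulateE // => ->.
  apply: eq_bigr => l _; rewrite fb //.
  by have := ltn_ord l; rewrite [X in (_ < X)%N]size_mkseq.
apply/memB2; exists f => x y; apply/eqP.
rewrite -subr_eq0 /ce_d1 opprK; apply/eqP; move: y.
apply: (@basis_ext K^o) => [d u v|j ltj].
  by rewrite lie_linearr !linearP scalerDr addrACA.
move: x; apply: (@basis_ext K^o) => [d u v|i lti].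
  by rewrite lie_linearl !linearP add_lfunE scale_lfunE scalerDr addrACA.
by rewrite wf // /ce_d1 addNr.
Qed.

(** Ties an explicit map to its F_3-vector. Stability under sums and opposites, together with the
    rank one case, lets the vector be assembled along the formula of the derivation. *)
Definition end_rep (D : 'End(L)) (f : form) : Prop :=
  forall k j, (k < n)%N -> (j < n)%N ->
    co k (D (b j)) = tval K (nth None f (k * n + j)).

Definition form_rep (w : bilform L) (f : form) : Prop :=
  forall i j, (i < n)%N -> (j < n)%N ->
    w (b i) (b j) = tval K (nth None f (i * n + j)).

Lemma end_repD D D' f f' :
  end_rep D f -> end_rep D' f' -> end_rep (D + D') (fadd f f').
Proof.
move=> h h' k j ltk ltj.
by rewrite add_lfunE coD h // h' // nth_fadd (tval_add charK).
Qed.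

Lemma end_repN D f : end_rep D f -> end_rep (- D) (fopp f).
Proof.
by move=> h k j ltk ltj; rewrite opp_lfunE coN h // nth_fopp tval_opp.
Qed.

Lemma form_repD w w' f f' :
  form_rep w f -> form_rep w' f' -> form_rep (w + w') (fadd f f').
Proof.
move=> h h' i j lti ltj.
by rewrite !add_lfunE h // h' // nth_fadd (tval_add charK).
Qed.

Lemma form_repN w f : form_rep w f -> form_rep (- w) (fopp f).
Proof.
by move=> h i j lti ltj; rewrite !opp_lfunE h // nth_fopp tval_opp.
Qed.

Lemma tval_fvar u i k j : (i < n)%N -> (j < n)%N ->
  tval K (nth None (fvar (u * n + i)) (k * n + j)) = ((k == u) && (j == i))%:R.
Proof.
move=> lti ltj; have n0 : (0 < n)%N by apply: leq_ltn_trans lti.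
rewrite nth_fvar; suff -> : (k * n + j == u * n + i)%N = (k == u) && (j == i).
  by case: (_ && _).
apply/eqP/andP => [e|[/eqP -> /eqP -> //]].
have := congr1 (divn^~ n) e; have := congr1 (modn^~ n) e => /=.
rewrite !modnMDl !divnMDl // !modn_small // !divn_small // !addn0.
by move=> -> ->.
Qed.

Lemma end_rep_tens u i (f : 'Hom(L, K^o)) : (u < n)%N -> (i < n)%N ->
    (forall j, (j < n)%N -> f (b j) = (j == i)%:R) ->
  end_rep (b u \ox f) (fvar (u * n + i)).
Proof.
move=> ltu lti fb k j ltk ltj; rewrite tensE coZ co_b // fb // tval_fvar //.
by rewrite -natrM mulnb andbC.
Qed.

Lemma form_rep_wedge i i' (f f' : 'Hom(L, K^o)) : (i < n)%N -> (i' < n)%N ->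
    (forall j, (j < n)%N -> f (b j) = (j == i)%:R) ->
    (forall j, (j < n)%N -> f' (b j) = (j == i')%:R) ->
  form_rep (f \wedge f') (fadd (fvar (i * n + i')) (fopp (fvar (i' * n + i)))).
Proof.
move=> lti lti' fb fb' k j ltk ltj.
rewrite wedgeE !fb // !fb' // nth_fadd nth_fopp (tval_add charK) tval_opp.
by rewrite !tval_fvar // -!natrM !mulnb [(j == i) && _]andbC.
Qed.

(** [quotient_basis] with Z the derivations and B the inner ones, both described by the table
    [c]. *)
Lemma H1_basis (outs coefs : seq form) (Ds : seq 'End(L)) :
    size Ds = size outs ->
    (forall m, (m < size outs)%N -> end_rep (nth 0 Ds m) (nth [::] outs m)) ->
    quotient_basis_check (n * n) (derivation_eqs n c) (inner_gens n c) outs coefs ->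
  (forall D, D \in Ds -> is_derivation D) /\ basis_of (H1 L) (map class1 Ds).
Proof.
move=> szD repD chk.
have coords m p : (m < size outs)%N -> (p < n * n)%N ->
    end_coords (nth 0 Ds m) p = tval K (nth None (nth [::] outs m) p).
  move=> ltm ltp; have [ltk ltj] := ltn_divmod ltp.
  by rewrite /end_coords /tabulate ltp repD // -divn_eq.
split=> [D DD|].
  apply/memDer; exact: (quotient_basis_mem charK (fun D p => @tabulate_large _ p)
    mem_Der_coords szD coords chk DD).
exact: (quotient_basis charK end_coords_linear (fun D p => @tabulate_large _ p)
  mem_Der_coords mem_Inn_coords szD coords chk).
Qed.

Lemma H2_basis (outs coefs : seq form) (ws : seq (bilform L)) :
    size ws = size outs ->
    (forall m, (m < size outs)%N -> form_rep (nth 0 ws m) (nth [::] outs m)) ->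
    quotient_basis_check (n * n) (cocycle_eqs n c) (coboundary_gens n c) outs coefs ->
  (forall w, w \in ws -> is_cocycle2 w) /\ basis_of (H2 L) (map class2 ws).
Proof.
move=> szw repw chk.
have coords m p : (m < size outs)%N -> (p < n * n)%N ->
    form_coords (nth 0 ws m) p = tval K (nth None (nth [::] outs m) p).
  move=> ltm ltp; have [lti ltj] := ltn_divmod ltp.
  by rewrite /form_coords /tabulate ltp repw // -divn_eq.
split=> [w ww|].
  apply/memZ2; exact: (quotient_basis_mem charK (fun w p => @tabulate_large _ p)
    mem_Z2_coords szw coords chk ww).
exact: (quotient_basis charK form_coords_linear (fun w p => @tabulate_large _ p)
  mem_Z2_coords mem_B2_coords szw coords chk).
Qed.

End LieCoordinates.

(** * Matrices over F_3 and the cohomology of gl(3) *)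

(* The 3 x 3 matrix A is stored as the vector whose entry 3 p + q is A_(p, q). *)
Definition mx_bracket (f g : form) (p q : nat) : trit :=
  tsum 3 (fun r =>
    tadd (tmul (nth None f (p * 3 + r)) (nth None g (r * 3 + q)))
      (topp (tmul (nth None g (p * 3 + r)) (nth None f (r * 3 + q))))).

Section MatrixRepresentation.
Variables (K : fieldType) (charK : 3%N \in [pchar K]).
Implicit Types (A B : gl K 3) (f g : form).

Definition mx_rep A f : Prop := forall p q, (p < 3)%N -> (q < 3)%N ->
  (A : 'M[K]_3) (inord p) (inord q) = tval K (nth None f (p * 3 + q)).

Lemma inord_eq n (i : 'I_n.+1) p : (p < n.+1)%N -> (inord p == i) = (p == i :> nat).
Proof. by move=> ltp; rewrite -val_eqE /= inordK. Qed.

Lemma mx_rep_E (i j : 'I_3) : mx_rep (E K i j) (fvar (i * 3 + j)).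
Proof.
by move=> p q ltp ltq; rewrite tval_fvar // mxE !inord_eq.
Qed.

Lemma mx_repD A B f g : mx_rep A f -> mx_rep B g -> mx_rep (A + B) (fadd f g).
Proof.
by move=> h h' p q ltp ltq; rewrite mxE h // h' // nth_fadd (tval_add charK).
Qed.

Lemma mx_repN A f : mx_rep A f -> mx_rep (- A) (fopp f).
Proof. by move=> h p q ltp ltq; rewrite mxE h // nth_fopp tval_opp. Qed.

Lemma mx_bracketP A B f g p q : mx_rep A f -> mx_rep B g ->
    (p < 3)%N -> (q < 3)%N ->
  ([lie A, B] : 'M[K]_3) (inord p) (inord q) = tval K (mx_bracket f g p q).
Proof.
move=> hA hB ltp ltq; rewrite gl_lieE !mxE -sumrB (tval_sum charK).
apply: eq_bigr => r _; rewrite (tval_add charK) tval_opp !tval_mul.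
by rewrite -!hA // -!hB // inord_val.
Qed.

End MatrixRepresentation.

Definition gl3_table (i j k : nat) : trit :=
  mx_bracket (fvar i) (fvar j) (k %/ 3) (k %% 3).

(* A |-> - tr(A) 1: the unit E_(p, q) has index 3 p + q, which for p, q < 3   *)
(* is divisible by 4 iff p = q. *)
Definition gl3_outer_derivation : form :=
  mkseq (fun p => if (p %/ 9 %% 4 == 0) && (p %% 9 %% 4 == 0)
                  then Some true else None)%N (9 * 9).

(* Read off by Gaussian elimination. As the identity is central, the          *)
(* coordinate over ad E_33 is taken to be 0. *)
Definition gl3_derivation_coefs : seq form :=
  let d k j := fvar (k * 9 + j) in
  [:: d 2 2; d 0 3; d 0 6; fopp (d 0 1); fadd (d 2 2) (fopp (d 1 1));
      fopp (d 2 1); fopp (d 0 2); fopp (d 1 2); [::]; fopp (d 0 0)]%N.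

(** Values on the matrix units of a functional whose differential is the given cocycle. The value on
    E_33 is normalized to 0 by adding a multiple of the trace, which vanishes on brackets. *)
Definition gl3_cocycle_coefs : seq form :=
  let w i j := fvar (i * 9 + j) in
  [:: fopp (w 2 6); fopp (w 0 1); fopp (w 0 2); w 0 3;
      fadd (w 1 3) (fopp (w 2 6)); w 2 3; w 0 6; w 1 6; [::]]%N.

Lemma gl3_derivation_check :
  quotient_basis_check (9 * 9) (derivation_eqs 9 gl3_table)
    (inner_gens 9 gl3_table) [:: gl3_outer_derivation] gl3_derivation_coefs.
Proof. by vm_compute. Qed.

(** With an empty list of representatives, the check says that every cocycle is a coboundary. *)
Lemma gl3_cocycle_check :
  quotient_basis_check (9 * 9) (cocycle_eqs 9 gl3_table)
    (coboundary_gens 9 gl3_table) [::] gl3_cocycle_coefs.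
Proof. by vm_compute. Qed.

Section Gl3.
Variables (K : fieldType) (charK : 3%N \in [pchar K]).

Definition gl3_unit (l : nat) : gl K 3 := E K (inord (l %/ 3)) (inord (l %% 3)).

Definition gl3_coord (k : nat) (A : gl K 3) : K :=
  (A : 'M[K]_3) (inord (k %/ 3)) (inord (k %% 3)).

Lemma divmod3 l : (l < 9)%N -> (l %/ 3 < 3)%N /\ (l %% 3 < 3)%N.
Proof. by rewrite ltn_mod -[9%N]/(3 * 3)%N ltn_divLR. Qed.

Lemma gl3_unit_rep l : (l < 9)%N -> mx_rep (gl3_unit l) (fvar l).
Proof.
move=> /divmod3[ltk ltj]; rewrite {2}(divn_eq l 3).
by have := mx_rep_E K (inord (l %/ 3)) (inord (l %% 3)); rewrite !inordK.
Qed.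

Lemma gl3_coord_linear k a (A B : gl K 3) :
  gl3_coord k (a *: A + B) = a * gl3_coord k A + gl3_coord k B.
Proof. by rewrite /gl3_coord !mxE. Qed.

Lemma gl3_coord_unit k j : (k < 9)%N -> (j < 9)%N ->
  gl3_coord k (gl3_unit j) = (k == j)%:R.
Proof.
move=> ltk ltj; have [ltk1 ltk2] := divmod3 ltk.
rewrite /gl3_coord gl3_unit_rep // -divn_eq nth_fvar.
by case: eqP.
Qed.

Lemma gl3_coord_sum (A : gl K 3) : A = \sum_(k < 9) gl3_coord k A *: gl3_unit k.
Proof.
apply/matrixP => p q; rewrite summxE (bigD1 (inord (p * 3 + q))) //= !mxE.
have ltpq : (p * 3 + q < 9)%N.
  by case: p q => [[|[|[|//]]] ?] [[|[|[|//]]] ?].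
rewrite /gl3_coord inordK // divnMDl // divn_small // addn0 modnMDl modn_small //.
rewrite !inord_val !eqxx mulr1 big1 ?addr0 // => k nek.
have [ltk1 ltk2] := divmod3 (ltn_ord k).
rewrite !mxE; case: andP => [[/eqP ep /eqP eq]|]; rewrite ?mulr0 //.
by move: nek; rewrite ep eq !inordK // -divn_eq inord_val eqxx.
Qed.

Lemma gl3_coord_lie i j k : (i < 9)%N -> (j < 9)%N -> (k < 9)%N ->
  gl3_coord k [lie gl3_unit i, gl3_unit j] = tval K (gl3_table i j k).
Proof.
move=> lti ltj /divmod3[ltk1 ltk2].
by apply: mx_bracketP => //; apply: gl3_unit_rep.
Qed.

(** The functional [D3d] is the trace, and 2 h_1 + h_2 is minus the identity in characteristic 3. *)
Lemma gl3_outer_rep (D3d : 'Hom(gl K 3, K^o)) :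
    (forall A : gl K 3, A \in sl_vs K 3 -> D3d A = 0) -> D3d D3 = 1 ->
  end_rep 9 gl3_unit gl3_coord
    (2 *: ((vsval h1 : gl K 3) \ox D3d) + (vsval h2 : gl K 3) \ox D3d)
    gl3_outer_derivation.
Proof.
move=> D3d_sl D3d_D3 k j ltk ltj.
(* Off-diagonal units are traceless, and so is the difference of a diagonal unit and [D3]. *)
have D3dE (p q : 'I_3) : D3d (E K p q) = (p == q)%:R.
  have [->|ne] := eqVneq p q; last by rewrite D3d_sl // E_sl_subproof.
  have : D3d (E K q q - D3) = 0.
    have trE (i : 'I_3) : \tr (E K i i : 'M[K]_3) = 1.
      rewrite /mxtrace (bigD1 i) //= mxE !eqxx big1 ?addr0 // => l nel.
      by rewrite mxE (negbTE nel).
    by apply: D3d_sl; rewrite mem_sl_vs linearB /= !trE subrr.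
  by rewrite linearB /= D3d_D3 => /eqP; rewrite subr_eq0 => /eqP.
rewrite add_lfunE scale_lfunE !tensE (two_pchar3 charK) D3dE val_h1 val_h2.
have ltp := ltn_index ltk ltj.
rewrite nth_mkseq // divnMDl // (divn_small ltj) addn0 modnMDl (modn_small ltj).
(* Among the indices 0, ..., 8 the diagonal units are 0, 4 and 8. *)
have -> : (inord (j %/ 3) == inord (j %% 3) :> 'I_3) = (j %% 4 == 0)%N.
  by move: j ltj {ltp}; do 9 (case=> [_|]; first by rewrite inord_eq ?inordK).
case: eqP => _; last first.
  by rewrite andbF !scale0r scaler0 addr0 /gl3_coord mxE.
have [ltk1 ltk2] := divmod3 ltk.
rewrite andbT !scale1r scaleN1r /gl3_coord !mxE !inord_eq //.
(* For the middle diagonal entry, to which - h_1 and h_2 both contribute 1. *)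
have two : 1 + 1 = -1 :> K := two_pchar3 charK.
move: k ltk {ltp ltk1 ltk2}; do 9 (case=> [_|]; first by
  rewrite /= ?expr1 !(subr0, sub0r, opprK, oppr0, addr0, add0r) ?two).
by [].
Qed.

Lemma gl3_H1 (D3d : 'Hom(gl K 3, K^o)) :
    (forall A : gl K 3, A \in sl_vs K 3 -> D3d A = 0) -> D3d D3 = 1 ->
  let c0 := 2 *: ((vsval h1 : gl K 3) \ox D3d) + (vsval h2 : gl K 3) \ox D3d in
  is_derivation c0 /\ basis_of (H1 (gl K 3)) [:: class1 c0].
Proof.
move=> D3d_sl D3d_D3 c0.
have [|der basis] := H1_basis charK gl3_coord_linear gl3_coord_sum gl3_coord_lie
  (outs := [:: gl3_outer_derivation]) (Ds := [:: c0]) erefl _ gl3_derivation_check.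
  by case=> // _; apply: gl3_outer_rep.
by split=> //; apply: der; rewrite inE.
Qed.

Lemma gl3_H2 : H2 (gl K 3) = 0%VS.
Proof.
have [//|_ /andP[/eqP <- _]] := H2_basis charK gl3_coord_linear gl3_coord_unit
  gl3_coord_sum gl3_coord_lie (outs := [::]) (ws := [::]) erefl _ gl3_cocycle_check.
exact: span_nil.
Qed.

End Gl3.

(** * Structure constants and certificates for psl(3) *)

(* The matrices x1, x2, x3, y1, y2, y3, h1; y3 = [y1, y2] = - E_31. *)
Definition sl3_forms : seq form :=
  [:: fvar 1; fvar 5; fvar 2; fvar 3; fvar 7; fopp (fvar 6);
      fadd (fvar 0) (fopp (fvar 4))].

Definition sl3_bracket (i j : nat) : nat -> nat -> trit :=
  mx_bracket (nth [::] sl3_forms i) (nth [::] sl3_forms j).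

(** Subtracting the scalar z_22 (indices from 0) from a traceless z kills its last diagonal entry.
    In characteristic 3 the remaining diagonal is z_00 - z_22 times that of [h1]. The sign of z_20
    comes from [y3]. *)
Definition psl3_table (i j k : nat) : trit :=
  let z := sl3_bracket i j in
  nth None [:: z 0 1; z 1 2; z 0 2; z 1 0; z 2 1; topp (z 2 0);
               tadd (z 0 0) (topp (z 2 2))]%N k.

(** In sl(3), a bracket and the combination given by the table differ exactly by the scalar matrix
    z_22. *)
Definition psl3_table_check : bool :=
  all (fun i => all (fun j => all (fun p => all (fun q =>
    tadd (sl3_bracket i j p q) (topp (tsum 7 (fun k =>
      tmul (psl3_table i j k) (nth None (nth [::] sl3_forms k) (p * 3 + q)))))
    == if p == q then sl3_bracket i j 2 2 else None)
  (iota 0 3)) (iota 0 3)) (iota 0 7)) (iota 0 7).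

Lemma psl3_tableP i j p q : (i < 7)%N -> (j < 7)%N -> (p < 3)%N -> (q < 3)%N ->
  tadd (sl3_bracket i j p q) (topp (tsum 7 (fun k =>
    tmul (psl3_table i j k) (nth None (nth [::] sl3_forms k) (p * 3 + q)))))
  = if p == q then sl3_bracket i j 2 2 else None.
Proof.
have : psl3_table_check by vm_compute.
move=> chk lti ltj ltp ltq; apply/eqP.
by apply: (allP (allP (allP (allP chk i _) j _) p _) q _); rewrite mem_iota.
Qed.

Section Psl3Forms.
(** The basis x1, x2, x3, y1, y2, y3, h1 is numbered from 0. As a vector, [d k j] is the rank one
    map sending b_j to b_k; as a form, it reads the entry (k, j). *)
Let d k j := fvar (k * 7 + j).
Let w i j := fadd (fvar (i * 7 + j)) (fopp (fvar (j * 7 + i))).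

Definition psl3_derivations : seq form :=
  [:: fadd (d 3 2) (d 5 0); fadd (d 4 2) (d 5 1);
      fadd (fopp (d 1 0)) (d 3 4); fadd (fopp (d 0 1)) (d 4 3);
      fadd (fadd (fadd (d 0 0) (fopp (d 1 1))) (fopp (d 3 3))) (d 4 4);
      fadd (d 0 5) (d 2 3); fadd (d 1 5) (d 2 4)]%N.

(** The first seven forms are coordinates over the ad b_l. The diagonal entries common to ad h_1 and
    the diagonal outer derivation are separated by a sum and a difference, since -1/2 = 1 in F_3;
    [psl3_cocycle_coefs] does the same for the entries (0, 3) and (1, 4). *)
Definition psl3_derivation_coefs : seq form :=
  [:: d 0 6; d 1 6; d 0 4; d 1 2; fopp (d 0 2); d 3 1; fadd (d 0 0) (d 1 1);
      d 3 2; d 4 2; fopp (d 1 0); fopp (d 0 1); fadd (fopp (d 0 0)) (d 1 1);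
      d 0 5; d 1 5]%N.

Definition psl3_cocycles : seq form :=
  [:: w 1 2; w 0 2; w 0 4; fadd (w 1 4) (fopp (w 0 3)); w 1 3; w 4 5; w 3 5]%N.

Definition psl3_cocycle_coefs : seq form :=
  [:: fopp (d 0 6); fopp (d 1 6); fopp (d 0 1); d 1 5; fopp (d 0 5);
      fopp (d 3 4); fadd (d 0 3) (d 1 4); d 1 2; d 0 2; d 0 4;
      fadd (d 0 3) (fopp (d 1 4)); d 1 3; d 4 5; d 3 5]%N.
End Psl3Forms.

Lemma psl3_derivation_check :
  quotient_basis_check (7 * 7) (derivation_eqs 7 psl3_table)
    (inner_gens 7 psl3_table) psl3_derivations psl3_derivation_coefs.
Proof. by vm_compute. Qed.

Lemma psl3_cocycle_check :
  quotient_basis_check (7 * 7) (cocycle_eqs 7 psl3_table)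
    (coboundary_gens 7 psl3_table) psl3_cocycles psl3_cocycle_coefs.
Proof. by vm_compute. Qed.

Definition derivation_degree_check (f : form) (e : int) : bool :=
  all (fun k => all (fun j => (nth None f (k * 7 + j) == None) ||
    (psl3_basis_deg`_k == psl3_basis_deg`_j + e)) (iota 0 7)) (iota 0 7).

Definition cochain_degree_check (f : form) (e : int) : bool :=
  all (fun i => all (fun j => (nth None f (i * 7 + j) == None) ||
    (psl3_basis_deg`_i + psl3_basis_deg`_j + e == 0)) (iota 0 7)) (iota 0 7).

Section Psl3.
Variables (K : fieldType) (charK : 3%N \in [pchar K]).

Definition sl3_elt (l : nat) : sl K 3 := nth 0 [:: x1; x2; x3; y1; y2; y3; h1] l.

Definition psl3_elt (l : nat) : psl K 3 := psl_pi (sl3_elt l).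

Definition psl3_coord (k : nat) (q : psl K 3) : K := coord (psl3_basis K) (inord k) q.

Lemma sl3_elt_rep l : (l < 7)%N ->
  mx_rep (vsval (sl3_elt l)) (nth [::] sl3_forms l).
Proof.
case: l => [|[|[|[|[|[|[|//]]]]]]] _; rewrite [sl3_elt _]/=.
- exact: (mx_rep_E K 0 1).
- exact: (mx_rep_E K 1 2).
- by rewrite val_x3; apply: (mx_rep_E K 0 2).
- exact: (mx_rep_E K 1 0).
- exact: (mx_rep_E K 2 1).
- by rewrite val_y3; apply/mx_repN/(mx_rep_E K 2 0).
by rewrite val_h1; apply: mx_repD (mx_rep_E K 0 0) (mx_repN (mx_rep_E K 1 1)).
Qed.

Lemma psl3_elt_basis (i : 'I_7) : (psl3_basis K)`_i = psl3_elt i.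
Proof. by case: i => -[|[|[|[|[|[|[|//]]]]]]] ?. Qed.

Lemma psl3_coord_linear k a (u v : psl K 3) :
  psl3_coord k (a *: u + v) = a * psl3_coord k u + psl3_coord k v.
Proof. exact: linearP. Qed.

Lemma psl3_dual_elt (i : 'I_7) j : (j < 7)%N ->
  psl3_dual K i (psl3_elt j) = (j == i)%:R.
Proof.
move=> ltj; rewrite psl3_dualE -(psl3_elt_basis (Ordinal ltj)).
by rewrite coord_free ?psl3_basis_free // -val_eqE.
Qed.

Lemma psl3_coord_elt k j : (k < 7)%N -> (j < 7)%N ->
  psl3_coord k (psl3_elt j) = (k == j)%:R.
Proof.
move=> ltk ltj; rewrite /psl3_coord -psl3_dualE psl3_dual_elt // inordK //.
by rewrite eq_sym.
Qed.

Lemma psl3_coord_sum (q : psl K 3) :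
  q = \sum_(k < 7) psl3_coord k q *: psl3_elt k.
Proof.
rewrite {1}(coord_basis (psl3_basisP charK) (memvf q)).
by apply: eq_bigr => k _; rewrite psl3_elt_basis /psl3_coord inord_val.
Qed.

Lemma psl3_lie i j : (i < 7)%N -> (j < 7)%N ->
  [lie psl3_elt i, psl3_elt j] =
  \sum_(k < 7) tval K (psl3_table i j k) *: psl3_elt k.
Proof.
move=> lti ltj; rewrite -[LHS]/(psl_lie _ _) -psl_pi_lie.
have -> : \sum_(k < 7) tval K (psl3_table i j k) *: psl3_elt k =
    psl_pi (\sum_(k < 7) tval K (psl3_table i j k) *: sl3_elt k).
  by rewrite linear_sum; apply: eq_bigr => k _; rewrite linearZ.
apply/eqP; rewrite vpi_eq; apply/mem_sl_scalars.
(* The scalar lost in passing from sl(3) to the quotient. *)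
exists (tval K (sl3_bracket i j 2 2)); apply/matrixP => p q.
rewrite linearB linear_sum !mxE summxE.
transitivity (tval K (tadd (sl3_bracket i j p q) (topp (tsum 7 (fun k =>
    tmul (psl3_table i j k) (nth None (nth [::] sl3_forms k) (p * 3 + q))))))).
  rewrite (tval_add charK) tval_opp (tval_sum charK); congr (_ - _).
    have := mx_bracketP charK (sl3_elt_rep lti) (sl3_elt_rep ltj)
      (ltn_ord p) (ltn_ord q).
    by rewrite !inord_val gl_lieE !mxE.
  apply: eq_bigr => k _; rewrite linearZ mxE tval_mul -sl3_elt_rep //.
  by rewrite !inord_val.
by rewrite psl3_tableP // -val_eqE; case: ifP; rewrite ?mulr1n ?mulr0n.
Qed.

Lemma psl3_coord_lie i j k : (i < 7)%N -> (j < 7)%N -> (k < 7)%N ->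
  psl3_coord k [lie psl3_elt i, psl3_elt j] = tval K (psl3_table i j k).
Proof.
move=> lti ltj ltk; rewrite psl3_lie // (co_lincomb psl3_coord_linear).
rewrite (bigD1 (Ordinal ltk)) //= psl3_coord_elt // eqxx mulr1 big1 ?addr0 // => l.
by rewrite -val_eqE /= psl3_coord_elt // eq_sym => /negbTE->; rewrite mulr0.
Qed.

Local Notation der_rep := (end_rep 7 psl3_elt psl3_coord).
Local Notation coc_rep := (form_rep 7 psl3_elt).

Lemma der_repD (D D' : 'End(psl K 3)) f f' :
  der_rep D f -> der_rep D' f' -> der_rep (D + D') (fadd f f').
Proof. by move=> h h'; apply: (end_repD charK psl3_coord_linear h h'). Qed.

Lemma der_repN (D : 'End(psl K 3)) f : der_rep D f -> der_rep (- D) (fopp f).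
Proof. by move=> h; apply: (end_repN psl3_coord_linear h). Qed.

Lemma der_rep_tens u (i : 'I_7) : (u < 7)%N ->
  der_rep (psl3_elt u \ox psl3_dual K i) (fvar (u * 7 + i)).
Proof.
move=> ltu; apply: (end_rep_tens psl3_coord_linear psl3_coord_elt) => // j.
exact: psl3_dual_elt.
Qed.

Lemma coc_rep_wedge (i j : 'I_7) :
  coc_rep (psl3_dual K i \wedge psl3_dual K j)
    (fadd (fvar (i * 7 + j)) (fopp (fvar (j * 7 + i)))).
Proof. by apply: form_rep_wedge => // k; apply: psl3_dual_elt. Qed.

Lemma psl3_grP e (v : psl K 3) : v \in psl3_gr K e ->
  exists2 t : 'I_7 -> K, (forall j, t j != 0 -> psl3_basis_deg`_j = e)
    & v = \sum_(j < 7) t j *: psl3_elt j.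
Proof.
case/memv_sumP => vs vsP ->.
exists (fun j : 'I_7 => if psl3_basis_deg`_j == e then psl3_coord j (vs j) else 0).
  by move=> j; case: ifP => [/eqP //|]; rewrite eqxx.
rewrite big_mkcond; apply: eq_bigr => j _.
case: ifP => [/vsP /vlineP[a ->]|_]; last by rewrite scale0r.
by rewrite psl3_elt_basis (coZ psl3_coord_linear) psl3_coord_elt // eqxx mulr1.
Qed.

Lemma mem_psl3_gr (k : 'I_7) : psl3_elt k \in psl3_gr K psl3_basis_deg`_k.
Proof.
rewrite -psl3_elt_basis; apply: subvP (memv_line _).
by rewrite /psl3_gr (sumv_sup k).
Qed.

Let mem_iota7 (i : 'I_7) : (i : nat) \in iota 0 7.
Proof. by rewrite mem_iota ltn_ord. Qed.

(** By linearity it suffices that each nonzero matrix entry joins basis vectors whose degrees differ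
    by [e]. *)
Lemma derivation_degreeP (D : 'End(psl K 3)) f e :
  der_rep D f -> derivation_degree_check f e -> derivation_degree D e.
Proof.
move=> repD chk e' v /psl3_grP[t tdeg ->].
rewrite linear_sum rpred_sum // => j _; rewrite linearZ /=.
have [->|/tdeg <-] := eqVneq (t j) 0; first by rewrite scale0r mem0v.
rewrite rpredZ // [X in X \in _]psl3_coord_sum rpred_sum // => k _.
rewrite repD //.
have /orP[] := allP (allP chk _ (mem_iota7 k)) _ (mem_iota7 j).
  by move=> /eqP ->; rewrite scale0r mem0v.
by move=> /eqP <-; rewrite rpredZ // mem_psl3_gr.
Qed.

Lemma cochain_degreeP (w : bilform (psl K 3)) f e :
  coc_rep w f -> cochain_degree_check f e -> cochain_degree w e.
Proof.
move=> repw chk e1 e2 u v /psl3_grP[t tdeg ->] /psl3_grP[s sdeg ->] ne0.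
rewrite linear_sum big1 // => j _; rewrite linearZ /=.
have [->|/sdeg dj] := eqVneq (s j) 0; first by rewrite scale0r.
rewrite linear_sum sum_lfunE big1 ?scaler0 // => i _; rewrite linearZ scale_lfunE /=.
have [->|/tdeg di] := eqVneq (t i) 0; first by rewrite scale0r.
rewrite repw //.
have /orP[] := allP (allP chk _ (mem_iota7 i)) _ (mem_iota7 j).
  by move=> /eqP ->; rewrite scaler0.
by rewrite di dj (negbTE ne0).
Qed.

End Psl3.

(** * Cohomology of psl(3) *)

Section Psl3Cohomology.
Variables (K : fieldType) (charK : 3%N \in [pchar K]).

Lemma psl3_derivations_rep m : (m < 7)%N ->
  end_rep 7 (@psl3_elt K) (@psl3_coord K)
    (nth 0 [:: psl_pi y1 \ox x3d + psl_pi y3 \ox x1d;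
               psl_pi y2 \ox x3d + psl_pi y3 \ox x2d;
               2 *: (psl_pi x2 \ox x1d) + psl_pi y1 \ox y2d;
               2 *: (psl_pi x1 \ox x2d) + psl_pi y2 \ox y1d;
               psl_pi x1 \ox x1d + 2 *: (psl_pi x2 \ox x2d)
               + 2 *: (psl_pi y1 \ox y1d) + psl_pi y2 \ox y2d;
               psl_pi x1 \ox y3d + psl_pi x3 \ox y1d;
               psl_pi x2 \ox y3d + psl_pi x3 \ox y2d] m)
    (nth [::] psl3_derivations m).
Proof.
(* The coefficients 2 become -1, as in the F_3-vectors. *)
rewrite (two_pchar3 charK) !scaleN1r.
have rep u i ltu := @der_rep_tens K u i ltu.
case: m => [|[|[|[|[|[|[|//]]]]]]] _.
- exact: (der_repD charK (rep 3%N 2 isT) (rep 5%N 0 isT)).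
- exact: (der_repD charK (rep 4%N 2 isT) (rep 5%N 1 isT)).
- exact: (der_repD charK (der_repN (rep 1%N 0 isT)) (rep 3%N 4 isT)).
- exact: (der_repD charK (der_repN (rep 0%N 1 isT)) (rep 4%N 3 isT)).
- exact: (der_repD charK (der_repD charK (der_repD charK
    (rep 0%N 0 isT) (der_repN (rep 1%N 1 isT))) (der_repN (rep 3%N 3 isT)))
    (rep 4%N 4 isT)).
- exact: (der_repD charK (rep 0%N 5 isT) (rep 2%N 3 isT)).
exact: (der_repD charK (rep 1%N 5 isT) (rep 2%N 4 isT)).
Qed.

Lemma psl3_cocycles_rep m : (m < 7)%N ->
  form_rep 7 (@psl3_elt K)
    (nth 0 [:: x2d \wedge x3d; x1d \wedge x3d; x1d \wedge y2d;
               x2d \wedge y2d - x1d \wedge y1d; x2d \wedge y1d;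
               y2d \wedge y3d; y1d \wedge y3d] m)
    (nth [::] psl3_cocycles m).
Proof.
have rep := @coc_rep_wedge K charK.
case: m => [|[|[|[|[|[|[|//]]]]]]] _.
- exact: (rep 1 2).
- exact: (rep 0 2).
- exact: (rep 0 4).
- exact: (form_repD charK (rep 1 4) (form_repN (rep 0 3))).
- exact: (rep 1 3).
- exact: (rep 4 5).
exact: (rep 3 5).
Qed.

Lemma psl3_H1 :
  let Dm3 := [:: psl_pi y1 \ox x3d + psl_pi y3 \ox x1d;
                 psl_pi y2 \ox x3d + psl_pi y3 \ox x2d] in
  let D0 := [:: 2 *: (psl_pi x2 \ox x1d) + psl_pi y1 \ox y2d;
                2 *: (psl_pi x1 \ox x2d) + psl_pi y2 \ox y1d;
                psl_pi x1 \ox x1d + 2 *: (psl_pi x2 \ox x2d)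
                + 2 *: (psl_pi y1 \ox y1d) + psl_pi y2 \ox y2d] in
  let Dp3 := [:: psl_pi x1 \ox y3d + psl_pi x3 \ox y1d;
                 psl_pi x2 \ox y3d + psl_pi x3 \ox y2d] in
  [/\ forall D : 'End(psl K 3), D \in Dm3 ++ D0 ++ Dp3 -> is_derivation D,
      forall D : 'End(psl K 3), D \in Dm3 -> derivation_degree D (- 3),
      forall D : 'End(psl K 3), D \in D0 -> derivation_degree D 0,
      forall D : 'End(psl K 3), D \in Dp3 -> derivation_degree D 3 &
      basis_of (H1 (psl K 3)) (map class1 (Dm3 ++ D0 ++ Dp3))].
Proof.
move=> Dm3 D0 Dp3.
have deg m e (ltm : (m < 7)%N) :=
  derivation_degreeP charK (e := e) (psl3_derivations_rep ltm).
have [der basis] := H1_basis charK (@psl3_coord_linear K)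
  (psl3_coord_sum charK) (psl3_coord_lie charK) (outs := psl3_derivations)
  (Ds := Dm3 ++ D0 ++ Dp3) erefl psl3_derivations_rep psl3_derivation_check.
split=> // D; rewrite !inE.
- by case/orP => /eqP ->; [apply: (deg 0%N _ isT) | apply: (deg 1%N _ isT)].
- by case/or3P => /eqP ->;
    [apply: (deg 2%N _ isT) | apply: (deg 3%N _ isT) | apply: (deg 4%N _ isT)].
by case/orP => /eqP ->; [apply: (deg 5%N _ isT) | apply: (deg 6%N _ isT)].
Qed.

Lemma psl3_H2 :
  let Cm3 := [:: x2d \wedge x3d; x1d \wedge x3d] in
  let C0 := [:: x1d \wedge y2d; x2d \wedge y2d - x1d \wedge y1d;
                x2d \wedge y1d] in
  let Cp3 := [:: y2d \wedge y3d; y1d \wedge y3d] in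
  [/\ forall w : bilform (psl K 3), w \in Cm3 ++ C0 ++ Cp3 -> is_cocycle2 w,
      forall w : bilform (psl K 3), w \in Cm3 -> cochain_degree w (- 3),
      forall w : bilform (psl K 3), w \in C0 -> cochain_degree w 0,
      forall w : bilform (psl K 3), w \in Cp3 -> cochain_degree w 3 &
      basis_of (H2 (psl K 3)) (map class2 (Cm3 ++ C0 ++ Cp3))].
Proof.
move=> Cm3 C0 Cp3.
have deg m e (ltm : (m < 7)%N) :=
  cochain_degreeP (e := e) (psl3_cocycles_rep ltm).
have [coc basis] := H2_basis charK (@psl3_coord_linear K) (@psl3_coord_elt K)
  (psl3_coord_sum charK) (psl3_coord_lie charK) (outs := psl3_cocycles)
  (ws := Cm3 ++ C0 ++ Cp3) erefl psl3_cocycles_rep psl3_cocycle_check.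
split=> // w; rewrite !inE.
- by case/orP => /eqP ->; [apply: (deg 0%N _ isT) | apply: (deg 1%N _ isT)].
- by case/or3P => /eqP ->;
    [apply: (deg 2%N _ isT) | apply: (deg 3%N _ isT) | apply: (deg 4%N _ isT)].
by case/orP => /eqP ->; [apply: (deg 5%N _ isT) | apply: (deg 6%N _ isT)].
Qed.

End Psl3Cohomology.


Theorem lemma2p10 (K : closedFieldType) (charK : 3%N \in [pchar K]) :
  [/\ (forall D3d : 'Hom(gl K 3, K^o),
         (forall A : gl K 3, A \in sl_vs K 3 -> D3d A = 0) -> D3d D3 = 1 ->
         let c0 := 2 *: ((vsval h1 : gl K 3) \ox D3d)
                   + (vsval h2 : gl K 3) \ox D3d in
         is_derivation c0 /\ basis_of (H1 (gl K 3)) [:: class1 c0]),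
      H2 (gl K 3) = 0%VS,
      (let Dm3 := [:: psl_pi y1 \ox x3d + psl_pi y3 \ox x1d;
                      psl_pi y2 \ox x3d + psl_pi y3 \ox x2d] in
       let D0 := [:: 2 *: (psl_pi x2 \ox x1d) + psl_pi y1 \ox y2d;
                     2 *: (psl_pi x1 \ox x2d) + psl_pi y2 \ox y1d;
                     psl_pi x1 \ox x1d + 2 *: (psl_pi x2 \ox x2d)
                     + 2 *: (psl_pi y1 \ox y1d) + psl_pi y2 \ox y2d] in
       let Dp3 := [:: psl_pi x1 \ox y3d + psl_pi x3 \ox y1d;
                      psl_pi x2 \ox y3d + psl_pi x3 \ox y2d] in
       [/\ forall D : 'End(psl K 3), D \in Dm3 ++ D0 ++ Dp3 -> is_derivation D,
           forall D : 'End(psl K 3), D \in Dm3 -> derivation_degree D (- 3),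
           forall D : 'End(psl K 3), D \in D0 -> derivation_degree D 0,
           forall D : 'End(psl K 3), D \in Dp3 -> derivation_degree D 3 &
           basis_of (H1 (psl K 3)) (map class1 (Dm3 ++ D0 ++ Dp3))])
    & \dim (H2 (psl K 3)) = 7%N /\
      (let Cm3 := [:: x2d \wedge x3d; x1d \wedge x3d] in
       let C0 := [:: x1d \wedge y2d;
                     x2d \wedge y2d - x1d \wedge y1d;
                     x2d \wedge y1d] in
       let Cp3 := [:: y2d \wedge y3d; y1d \wedge y3d] in
       [/\ forall w : bilform (psl K 3), w \in Cm3 ++ C0 ++ Cp3 -> is_cocycle2 w,
           forall w : bilform (psl K 3), w \in Cm3 -> cochain_degree w (- 3),
           forall w : bilform (psl K 3), w \in C0 -> cochain_degree w 0,
           forall w : bilform (psl K 3), w \in Cp3 -> cochain_degree w 3 &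
           basis_of (H2 (psl K 3)) (map class2 (Cm3 ++ C0 ++ Cp3))])].
Proof.
split.
- exact: gl3_H1.
- exact: gl3_H2.
- exact: psl3_H1.
have h := psl3_H2 charK; split=> //; case: h => _ _ _ _ basis.
exact: size_basis basis.
Qed.
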